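(* Let $V$ be a finite nonempty set, $P=(P_{x,y})_{x,y\in V}$ a strictly sub-stochastic and irreducible transition kernel, and $\lambda=(\lambda_x)_{x\in V}\in[0,\infty)^V$. Let $\sigma=(\sigma_x)_{x\in V}\in[0,1]^V$ and $\nu=(\nu_x)_{x\in V}\in[0,\infty)^V$ satisfy $\sigma_x\le \frac{\lambda_x}{1+\lambda_x}$ for all $x\in V$. Then the system of equations $$s_x=-m_x+\sigma_x+\nu_x+\sum_{y\in V}m_yP_{y,x},\qquad x\in V,$$ $$s_x=\sigma_x e^{-(\nu_x+\sum_{y} m_yP_{y,x})}+\frac{\lambda_x}{1+\lambda_x}\left(1-e^{-(\nu_x+\sum_{y} m_yP_{y,x})}\right),\qquad x\in V,$$ has a unique solution $(s_*,m_* )$ with $s_*\in[0,1]^V$ and $m_*\in[0,\infty)^V$. Moreover, as $n\to\infty$, the random vectors $s_*^{(n)}=\frac1n S_*^{(n)}$ and $m_*^{(n)}=\frac1n M_*^{(n)}$ associated with the village model of activated random walk with parameters $V,P,\lambda,\sigma,\nu$ and $n$ houses per village converge in probability to the deterministic limits $s_*$ and $m_*$, respectively.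
   Context: Strictly sub-stochastic and irreducible means: $P_{x,y}\ge 0$ for all $x,y\in V$; $\sum_{y\in V}P_{x,y}\le 1$ for all $x\in V$, with strict inequality for at least one $x$; and for all $x,y\in V$ there is an integer $\ell\ge 0$ with $(P^\ell)_{x,y}>0$. Village model of activated random walk (VARW). For an integer $n\ge1$, the set of sites is $V_n=V\times[n]$, $[n]=\{1,\dots,n\}$; the site $(x,i)$ is called the $i$-th house of village $x$. The state at each time is a configuration of particles in the houses, each particle being active or sleepy. All particles in a house with two or more particles are active; a particle alone in its house may be active or sleepy. The continuous-time Markov dynamics is: each active particle jumps at rate 1; a particle that jumps from a house in village $x$ disappears from the system with probability $1-\sum_{y}P_{x,y}$, and otherwise chooses village $y$ with probability $P_{x,y}$ and lands in a uniformly chosen house of village $y$ (so an active particle in house $(x,i)$ jumps to house $(y,j)$ at rate $\frac1n P_{x,y}$). Each active particle that is alone in a house of village $x$ falls asleep at rate $\lambda_x$. Sleepy particles do not move, but a sleepy particle becomes active immediately whenever another active particle arrives in its house. Initial configuration: for each $x\in V$, $\lfloor\sigma_x n\rfloor$ houses in village $x$ are selected (arbitrarily, deterministically) and one sleepy particle is put in each of them; then $\lfloor \nu_x n\rfloor$ active particles are added to village $x$, each in an independently and uniformly chosen house of village $x$ (waking up any sleepy particle in that house). Almost surely the system terminates (stabilizes) in a final configuration in which each house contains at most one particle and all remaining particles are sleepy. $S_*^{(n)}=(S_*^{(n)}(x))_{x\in V}$, where $S_*^{(n)}(x)$ is the number of sleepy particles in village $x$ in the final stable configuration. $M_*^{(n)}=(M_*^{(n)}(x))_{x\in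 V}$, where $M_*^{(n)}(x)$ is the total number of times a particle jumped from a house in village $x$ during stabilization (the initial placement does not count as jumps). *)

(* Defs.v *)
From HB Require Import structures.
From mathcomp Require Import all_boot all_order all_algebra.
From mathcomp Require Import all_classical all_reals all_analysis.
From mathcomp Require Import measurable_realfun.

Set Implicit Arguments.
Unset Strict Implicit.
Unset Printing Implicit Defensive.

Import Order.TTheory GRing.Theory Num.Theory.
Import numFieldNormedType.Exports.

Local Open Scope classical_set_scope.
Local Open Scope ring_scope.

Fixpoint kernel_pow (R : realType) (V : finType) (P : V -> V -> R) (l : nat)
    (x y : V) : R :=
  if l is l'.+1 then \sum_(z : V) P x z * kernel_pow P l' z y
  else (x == y)%:R.

Definition substochastic_irreducible (R : realType) (V : finType)
    (P : V -> V -> R) : Prop :=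
  [/\ forall x y, 0 <= P x y,
      forall x, \sum_(y : V) P x y <= 1,
      exists x, \sum_(y : V) P x y < 1 &
      forall x y, exists l : nat, 0 < kernel_pow P l x y].

Definition inflow (R : realType) (V : finType) (P : V -> V -> R)
    (nu m : V -> R) (x : V) : R :=
  nu x + \sum_(y : V) m y * P y x.

Definition fluid_solution (R : realType) (V : finType) (P : V -> V -> R)
    (lambda sigma nu : V -> R) (s m : {ffun V -> R}) : Prop :=
  [/\ forall x, 0 <= s x <= 1,
      forall x, 0 <= m x,
      forall x, s x = - m x + sigma x + nu x + \sum_(y : V) m y * P y x &
      forall x, s x = sigma x * expR (- inflow P nu m x)
                    + lambda x / (1 + lambda x)
                      * (1 - expR (- inflow P nu m x))].

(** Markov jump processes, through their jump chain [Y] and holding times [T].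
    The dynamics is given by a finite set [E] of transitions: in state [z],
    transition [e] occurs at rate [rate z e] and leads to [step z e].  A state
    of total rate 0 is absorbing, and its holding time is [+oo]. *)

Definition exit_rate (R : realType) (S : eqType) (E : finType)
    (rate : S -> E -> R) (z : S) : R :=
  \sum_(e : E) rate z e.

Definition jump_prob (R : realType) (S : eqType) (E : finType)
    (rate : S -> E -> R) (step : S -> E -> S) (z z' : S) : R :=
  if exit_rate rate z == 0 then (z == z')%:R
  else (\sum_(e : E | step z e == z') rate z e) / exit_rate rate z.

(** [Y] is a Markov chain with initial law [init] and transition matrix
    [jump_prob]; given [Y], the [T i] are independent and exponential with
    parameters [exit_rate rate (Y i)]. *)
Definition markov_jump_process (R : realType) (d : measure_display)
    (Omega : measurableType d) (Pr : probability Omega R)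
    (S : eqType) (E : finType) (init : S -> R)
    (rate : S -> E -> R) (step : S -> E -> S)
    (Y : nat -> Omega -> S) (T : nat -> Omega -> \bar R) : Prop :=
  [/\ forall i z, measurable [set w | Y i w = z],
      forall i, measurable_fun setT (T i),
      forall i w, (0 < T i w)%E &
      forall (k : nat) (z : nat -> S) (t : nat -> R),
        (forall i, 0 <= t i) ->
        Pr [set w | forall i, (i <= k)%N ->
                      Y i w = z i /\ ((t i)%:E < T i w)%E] =
        (init (z 0%N)
         * (\prod_(i < k) jump_prob rate step (z i) (z i.+1))
         * (\prod_(i < k.+1) expR (- (exit_rate rate (z i) * t i))))%:E].

Definition jump_time (R : realType) (Omega : Type) (T : nat -> Omega -> \bar R)
    (k : nat) (w : Omega) : \bar R :=
  (\sum_(i < k) T i w)%E.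

(** The state at time [t]; [None] after an explosion (an event of probability
    0 when the exit rates are bounded along the trajectory). *)
Definition state_at (R : realType) (Omega : Type) (S : choiceType)
    (Y : nat -> Omega -> S) (T : nat -> Omega -> \bar R)
    (t : R) (w : Omega) : option S :=
  xget None [set Some (Y k w) | k in
    [set k | (jump_time T k w <= t%:E < jump_time T k.+1 w)%E]].

(** The eventual value of the process; [z0] is a default value for the
    trajectories (of probability 0 in an absorbed process) that have none. *)
Definition final_state (R : realType) (Omega : Type) (S : choiceType) (z0 : S)
    (Y : nat -> Omega -> S) (T : nat -> Omega -> \bar R) (w : Omega) : S :=
  xget z0 [set z | exists t0 : R,
                     forall t : R, 0 <= t -> t0 <= t ->
                       state_at Y T t w = Some z].

(** The village model.  House [(x, i)] is in state [None] when it contains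
    exactly one sleepy particle, and in state [Some k] when it contains [k]
    active particles and no sleepy one. *)

Definition house (V : finType) (n : nat) : finType := (V * 'I_n)%type.

Definition config (V : finType) (n : nat) : choiceType :=
  {ffun house V n -> option nat}.

(** The second component counts, for each village, the jumps performed so far
    from its houses. *)
Definition varw_state (V : finType) (n : nat) : choiceType :=
  (config V n * {ffun V -> nat})%type.

Definition active_at (V : finType) (n : nat) (c : config V n) (h : house V n)
    : nat :=
  if c h is Some k then k else 0%N.

Definition depart (V : finType) (n : nat) (h : house V n) (c : config V n)
    : config V n :=
  [ffun h' => if h' == h then Some (active_at c h).-1 else c h'].

Definition arrive (V : finType) (n : nat) (h : house V n) (c : config V n)
    : config V n :=
  [ffun h' => if h' == h then (if c h is Some k then Some k.+1 else Some 2%N)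
              else c h'].

Definition fall_asleep (V : finType) (n : nat) (h : house V n)
    (c : config V n) : config V n :=
  [ffun h' => if h' == h then None else c h'].

Definition count_jump (V : finType) (x : V) (M : {ffun V -> nat})
    : {ffun V -> nat} :=
  [ffun y => (M y + (y == x))%N].

(** [inl (h, Some h')]: a particle jumps from [h] to [h'];
    [inl (h, None)]: a particle jumps from [h] out of the system;
    [inr h]: the particle alone in [h] falls asleep. *)
Definition varw_event (V : finType) (n : nat) : finType :=
  (house V n * option (house V n) + house V n)%type.

Definition varw_step (V : finType) (n : nat) (z : varw_state V n)
    (e : varw_event V n) : varw_state V n :=
  match e with
  | inl (h, Some h') => (arrive h' (depart h z.1), count_jump h.1 z.2)
  | inl (h, None) => (depart h z.1, count_jump h.1 z.2)
  | inr h => (fall_asleep h z.1, z.2)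
  end.

Definition varw_rate (R : realType) (V : finType) (P : V -> V -> R)
    (lambda : V -> R) (n : nat) (z : varw_state V n) (e : varw_event V n) : R :=
  match e with
  | inl (h, Some h') => (active_at z.1 h)%:R * (P h.1 h'.1 / n%:R)
  | inl (h, None) => (active_at z.1 h)%:R * (1 - \sum_(y : V) P h.1 y)
  | inr h => if z.1 h == Some 1%N then lambda h.1 else 0
  end.

(** Initially, there is a sleepy particle in each house of [A]; the [N x]
    particles added to village [x] are the pairs [existT x j], and particle [p]
    is put in house [(tag p, f p)]. *)
Definition added (V : finType) (N : V -> nat) : finType := {x : V & 'I_(N x)}.

Definition init_config (V : finType) (n : nat) (A : {set house V n})
    (N : V -> nat) (f : {ffun added N -> 'I_n}) : config V n :=
  [ffun h => let k := #|[set p : added N | (tag p, f p) == h]| in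
             if h \in A then (if k == 0%N then None else Some k.+1)
             else Some k].

(** The houses of the added particles are independent and uniform, i.e. [f] is
    uniform. *)
Definition varw_init (R : realType) (V : finType) (n : nat)
    (A : {set house V n}) (N : V -> nat) (z : varw_state V n) : R :=
  #|[set f : {ffun added N -> 'I_n} |
      z == (init_config A f, [ffun=> 0%N])]|%:R
  / #|{ffun added N -> 'I_n}|%:R.

Definition is_varw (R : realType) (V : finType) (P : V -> V -> R)
    (lambda sigma nu : V -> R) (n : nat) (A : {set house V n})
    (d : measure_display) (Omega : measurableType d) (Pr : probability Omega R)
    (Y : nat -> Omega -> varw_state V n) (T : nat -> Omega -> \bar R) : Prop :=
  (forall x : V,
     #|[set i : 'I_n | (x, i) \in A]| = Num.truncn (sigma x * n%:R)) /\
  markov_jump_process Pr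
    (varw_init R A (fun x => Num.truncn (nu x * n%:R)))
    (@varw_rate R V P lambda n) (@varw_step V n) Y T.

Definition varw_final (R : realType) (V : finType) (n : nat) (Omega : Type)
    (Y : nat -> Omega -> varw_state V n) (T : nat -> Omega -> \bar R)
    : Omega -> varw_state V n :=
  final_state ([ffun=> Some 0%N], [ffun=> 0%N]) Y T.

Definition sleepy_count (R : realType) (V : finType) (n : nat) (Omega : Type)
    (Y : nat -> Omega -> varw_state V n) (T : nat -> Omega -> \bar R)
    (w : Omega) (x : V) : nat :=
  #|[set i : 'I_n | (varw_final Y T w).1 (x, i) == None]|.

Definition jump_count (R : realType) (V : finType) (n : nat) (Omega : Type)
    (Y : nat -> Omega -> varw_state V n) (T : nat -> Omega -> \bar R)
    (w : Omega) (x : V) : nat :=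
  (varw_final Y T w).2 x.

(** Convergence in probability, for the sup norm on [V -> R], of random vectors
    that may live on different probability spaces. *)
Definition cvg_in_probability (R : realType) (V : finType)
    (d : nat -> measure_display) (Omega : forall n, measurableType (d n))
    (Pr : forall n, probability (Omega n) R)
    (X : forall n, Omega n -> V -> R) (l : V -> R) : Prop :=
  forall eps : R, 0 < eps ->
    (fun n => Pr n [set w | exists x, eps < `|X n w x - l x|]) @ \oo --> 0%E.

(* Main.v *)
Require Import Defs.
From mathcomp Require Import all_boot all_order all_algebra.
From mathcomp Require Import all_classical all_reals all_analysis.
From mathcomp Require Import measurable_realfun.
From mathcomp Require Import ring lra.

Import Order.TTheory GRing.Theory Num.Theory.
Import numFieldNormedType.Exports.

Set Implicit Arguments.
Unset Strict Implicit.
Unset Printing Implicit Defensive.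

Local Open Scope classical_set_scope.
Local Open Scope ring_scope.

(* Let w satisfy P w + 1 <= w, which exists because P is strictly
   sub-stochastic and irreducible.  The fluid equations reduce to
   i = nu + g(i) P for the inflow i, where g is nondecreasing and 1-Lipschitz; w
   yields existence, uniqueness and stability under perturbation.

   For the particle system, three kinds of functions of the current state control
   the final one.
   - V = 2 sum_x w_x #particles(x) + #active: its generator is at most minus the
     total jump rate, so that the system is absorbed and performs O(n) jumps.
   - For each x, the number of arrivals in x minus its compensator
     sum_y M_y P_{y,x}: a martingale with bounded increments.
   - For each x, Psi_x = #{houses with one sleeper} - lambda_x #{empty houses}:
     sleeping and jumping of isolated particles cancel in mean, and an arrival
     multiplies its mean by 1 - 1/n, so that Psi_x minus its initial value times
     (1 - 1/n)^#arrivals has a square whose drift is at most a multiple of the jump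
     rate.
   A sum of the squares of the last two and of a multiple of V is a nonnegative
   supermartingale of initial mean O(n).  Hence both quantities are o(n) at
   absorption, where they say that (S/n, M/n) almost solves the fluid equations.
   Working with the generator on the current state alone, no abelian property or
   coupling is needed. *)

(** * The kernel and the fluid equations *)

Section Kernel.
Variables (R : realType) (V : finType) (P : V -> V -> R).

(** Probability that the walk with kernel [P], killed with the missing mass, is still in [V] after
    [l] steps from [x]. *)
Definition survival (l : nat) (x : V) : R := \sum_(y : V) kernel_pow P l x y.

Lemma survival0 x : survival 0 x = 1.
Proof.
rewrite /survival (bigD1 x)//= eqxx big1 ?addr0// => y /negPf yx.
by rewrite eq_sym yx.
Qed.

Lemma survivalS l x : survival l.+1 x = \sum_y P x y * survival l y.
Proof.
rewrite /survival /= exchange_big/=; apply: eq_bigr => y _.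
by rewrite -big_distrr.
Qed.

Lemma survivalD l k x :
  survival (l + k) x = \sum_y kernel_pow P l x y * survival k y.
Proof.
elim: l x => [|l IH] x.
  rewrite (bigD1 x)//= eqxx mul1r big1 ?addr0// => y /negPf yx.
  by rewrite eq_sym yx mul0r.
rewrite addSn survivalS.
under eq_bigr do rewrite IH big_distrr/=.
rewrite exchange_big/=; apply: eq_bigr => y _.
by rewrite big_distrl/=; apply: eq_bigr => z _; rewrite mulrA.
Qed.

Hypothesis P_irr : substochastic_irreducible P.

Let P_ge0 x y : 0 <= P x y. Proof. by case: P_irr. Qed.

Lemma kernel_pow_ge0 l x y : 0 <= kernel_pow P l x y.
Proof.
elim: l x => [|l IH] x /=; first exact: ler0n.
by apply: sumr_ge0 => z _; rewrite mulr_ge0.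
Qed.

Lemma survival_ge0 l x : 0 <= survival l x.
Proof. by apply: sumr_ge0 => y _; exact: kernel_pow_ge0. Qed.

Lemma survival_decr l x : survival l.+1 x <= survival l x.
Proof.
elim: l x => [|l IH] x.
  rewrite survival0 survivalS.
  under eq_bigr do rewrite survival0 mulr1.
  by case: P_irr.
by rewrite survivalS (survivalS l); apply: ler_sum => y _; rewrite ler_wpM2l.
Qed.

Lemma survival_le l k x : (l <= k)%N -> survival k x <= survival l x.
Proof.
move=> /subnK <-; elim: (k - l)%N => [//|j IH].
by rewrite addSn (le_trans (survival_decr _ _)).
Qed.

(** By irreducibility the walk reaches, with positive probability in [l] steps, a village [x0] where
    mass leaks; one more step then loses some of it. *)
Lemma survival_lt1 x : exists l, survival l x < 1.
Proof.
have [_ _ [x0 x0P] /(_ x x0)[l lP]] := P_irr.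
exists (l + 1)%N; rewrite survivalD.
have sx0 : survival 1 x0 < 1.
  by rewrite survivalS; under eq_bigr do rewrite survival0 mulr1.
(* Termwise comparison of [survival (l + 1) x] with [survival l x]; only the term [x0] has to be
   strict. *)
apply: (@lt_le_trans _ _ (survival l x)); last first.
  by rewrite -(survival0 x); exact: survival_le.
rewrite /survival [ltRHS](bigD1 x0)//= [ltLHS](bigD1 x0)//=.
apply: ltr_leD; first by rewrite gtr_pMr.
apply: ler_sum => y _; rewrite ler_piMr ?kernel_pow_ge0//.
have := survival_le y (leq0n 1); rewrite survival0; exact.
Qed.

(* [w] is a multiple of the expected number of steps spent in [V] before a large
   time. *)
Lemma exit_time_supersolution :
  exists w : V -> R, (forall x, 0 <= w x) /\
    forall x, \sum_y P x y * w y + 1 <= w x.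
Proof.
have [f fP] := choice survival_lt1.
pose L := \max_x f x.
have LP x : survival L x < 1.
  by apply: le_lt_trans (fP x); apply: survival_le; exact: leq_bigmax.
(* The candidate telescopes: [w x] minus its image under [P] is [c * (1 - survival L x)]. This must
   be at least 1 for every [x], and the sum dominates each of the required constants. *)
pose c := \sum_x (1 - survival L x)^-1.
have pos x : 0 < (1 - survival L x)^-1 by rewrite invr_gt0 subr_gt0.
have cP x : 1 <= c * (1 - survival L x).
  rewrite -ler_pdivrMr ?subr_gt0// div1r /c (bigD1 x)//= lerDl.
  by apply: sumr_ge0 => y _; exact: ltW.
have c0 : 0 <= c by apply: sumr_ge0 => x _; exact: ltW.
exists (fun x => c * \sum_(l < L) survival l x); split=> x.
  by rewrite mulr_ge0// sumr_ge0// => l _; exact: survival_ge0.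
rewrite [X in X + 1 <= _](_ : _ = c * \sum_(l < L) survival l.+1 x); last first.
  rewrite big_distrr/=; under [RHS]eq_bigr do rewrite survivalS big_distrr/=.
  rewrite [RHS]exchange_big/=; apply: eq_bigr => y _.
  by rewrite mulrCA big_distrr/= big_distrr/=; apply: eq_bigr => l _; rewrite mulrCA.
have -> : \sum_(l < L) survival l.+1 x = \sum_(l < L) survival l x - 1 + survival L x.
  have := big_ord_recr L (fun i : 'I_L.+1 => survival i x) (op := +%R) (idx := 0).
  rewrite big_ord_recl /= => e.
  have {}e : survival 0 x + \sum_(l < L) survival l.+1 x = \sum_(l < L) survival l x + survival L x by exact: e.
  by rewrite survival0 in e; lra.
have := cP x.
lra.
Qed.

End Kernel.

(** * Comparison by means of a supersolution *)

Section Stability.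
Variables (R : realType) (V : finType) (P : V -> V -> R) (w : V -> R).
Hypothesis P_ge0 : forall x y, 0 <= P x y.
Hypothesis w_ge0 : forall x, 0 <= w x.
Hypothesis Pw_le : forall x, \sum_y P x y * w y + 1 <= w x.

(** Pair the inequality on [D] with [w] and move [P] onto [w]: since [P w + 1 <= w], the sum of
    [w x * D x] absorbs the transported term and leaves the sum of [D] over. *)
Lemma sum_le_supersolution (D e : V -> R) : (forall x, 0 <= D x) ->
  (forall x, D x <= \sum_y D y * P y x + e x) ->
  \sum_x D x <= \sum_x w x * e x.
Proof.
move=> D0 De.
have h : \sum_x w x * D x <= \sum_y D y * (\sum_x P y x * w x) + \sum_x w x * e x.
  have -> : \sum_y D y * (\sum_x P y x * w x) = \sum_x w x * (\sum_y D y * P y x).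
    under eq_bigr do rewrite big_distrr/=.
    under [RHS]eq_bigr do rewrite big_distrr/=.
    rewrite exchange_big/=; apply: eq_bigr => x _; apply: eq_bigr => y _; ring.
  by rewrite -big_split/=; apply: ler_sum => x _; rewrite -mulrDr ler_wpM2l.
have : \sum_y D y * (\sum_x P y x * w x) + \sum_x D x <= \sum_x w x * D x.
  rewrite -big_split/=; apply: ler_sum => x _.
  by rewrite -{2}(mulr1 (D x)) -mulrDr mulrC ler_wpM2r.
lra.
Qed.

End Stability.

Lemma expRN_sub_ge0 (R : realType) (a b : R) : a <= b -> 0 <= expR (- a) - expR (- b).
Proof. by move=> ab; rewrite subr_ge0 ler_expR lerN2. Qed.

Lemma expRN_sub_le (R : realType) (a b : R) : 0 <= a -> a <= b ->
  expR (- a) - expR (- b) <= b - a.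
Proof.
move=> a0 ab.
have -> : - b = - a + - (b - a) by ring.
rewrite expRD -{1}(mulr1 (expR (- a))) -mulrBr.
have e1 : expR (- a) <= 1 by rewrite -expR0 ler_expR oppr_le0.
have := expR_ge1Dx (- (b - a)) => h.
have h2 : expR (- (b - a)) <= 1 by rewrite -expR0 ler_expR oppr_le0 subr_ge0.
have := expR_ge0 (- a).
nra.
Qed.

(** * Stability of the fluid equations *)

Section Fluid.
Variables (R : realType) (V : finType) (P : V -> V -> R) (lambda sigma nu : V -> R).
Hypothesis P_irr : substochastic_irreducible P.
Hypothesis lambda_ge0 : forall x, 0 <= lambda x.
Hypothesis sigma_01 : forall x, 0 <= sigma x <= 1.
Hypothesis nu_ge0 : forall x, 0 <= nu x.
Hypothesis sigma_le : forall x, sigma x <= lambda x / (1 + lambda x).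

Let P_ge0 x y : 0 <= P x y. Proof. by case: P_irr. Qed.

(** Final density of sleepers for an inflow [i]: a proportion [expR (- i)] of the houses is never
    visited and keeps its initial state; in a visited house the last particle sleeps before jumping
    with probability [lambda x / (1 + lambda x)]. *)
Definition stable_density (x : V) (i : R) : R :=
  sigma x * expR (- i) + lambda x / (1 + lambda x) * (1 - expR (- i)).

(** The map [g] of the overview: the number of jumps per house that mass balance forces for an
    inflow [i]. *)
Definition outflow (x : V) (i : R) : R := sigma x + i - stable_density x i.

Lemma asleep_prob_ge0 x : 0 <= lambda x / (1 + lambda x).
Proof. by rewrite divr_ge0// addr_ge0. Qed.

Lemma asleep_prob_lt1 x : lambda x / (1 + lambda x) < 1.
Proof. by rewrite ltr_pdivrMr ?mul1r; have := lambda_ge0 x; lra. Qed.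

Lemma outflow0 x : outflow x 0 = 0.
Proof. rewrite /outflow /stable_density oppr0 expR0; ring. Qed.

(** The increment is [b - a] minus [lambda x / (1 + lambda x) - sigma x], which lies between 0 and
    1, times [expR (- a) - expR (- b)], which lies between 0 and [b - a]. *)
Lemma outflow_diff x a b : 0 <= a -> a <= b ->
  0 <= outflow x b - outflow x a <= b - a.
Proof.
move=> a0 ab; have := asleep_prob_ge0 x; have := asleep_prob_lt1 x.
have := sigma_01 x; have := sigma_le x; rewrite /outflow /stable_density.
have := expRN_sub_ge0 ab; have := expRN_sub_le a0 ab.
set ea := expR (- a); set eb := expR (- b); set r := lambda x / _.
move=> h1 h2 h3 /andP[h4 _] h5 h6; apply/andP; split; nra.
Qed.

Lemma stable_density_01 x i : 0 <= i -> 0 <= stable_density x i <= 1.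
Proof.
move=> i0; have := asleep_prob_ge0 x; have := asleep_prob_lt1 x.
have := sigma_01 x; have := sigma_le x; rewrite /stable_density.
have : expR (- i) <= 1 by rewrite -expR0 ler_expR oppr_le0.
have := expR_ge0 (- i).
set e := expR (- i); set r := lambda x / _.
move=> h1 h2 h3 /andP[h4 _] h5 h6; apply/andP; split; nra.
Qed.

Lemma outflow_lip x a b : 0 <= a -> 0 <= b ->
  `|outflow x a - outflow x b| <= `|a - b|.
Proof.
move=> a0 b0; have [ab|/ltW ab] := leP a b.
  have /andP[h1 h2] := outflow_diff x a0 ab.
  by rewrite distrC (distrC a) !ger0_norm// subr_ge0.
have /andP[h1 h2] := outflow_diff x b0 ab.
by rewrite !ger0_norm// subr_ge0.
Qed.

Lemma inflow_ge0 (m : V -> R) x : (forall x, 0 <= m x) -> 0 <= inflow P nu m x.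
Proof. by move=> m0; rewrite addr_ge0// sumr_ge0// => y _; rewrite mulr_ge0. Qed.

Lemma inflow_lip (m m' : V -> R) x :
  `|inflow P nu m x - inflow P nu m' x| <= \sum_y `|m y - m' y| * P y x.
Proof.
rewrite /inflow opprD addrACA subrr add0r -sumrB.
apply: le_trans (ler_norm_sum _ _ _) _; apply: ler_sum => y _.
by rewrite -mulrBl normrM (ger0_norm (P_ge0 _ _)).
Qed.

Lemma fluid_solution_outflow (s m : {ffun V -> R}) x :
  fluid_solution P lambda sigma nu s m -> m x = outflow x (inflow P nu m x).
Proof.
move=> [_ _ h1 h2]; have e1 := h1 x; have e2 := h2 x.
rewrite /outflow /stable_density -e2 e1 /inflow; lra.
Qed.

(** Let [D] be the difference of the inflows. As [outflow] is 1-Lipschitz, [m' - m] is at most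
    [D + 2 * e]; transporting this by [P] gives [D] as a subsolution with source of order [e], which
    the supersolution [w] bounds. The pair [s'], [m'] is arbitrary: the case [e = 0] is uniqueness,
    the case of small [e] handles the particle system. *)
Lemma fluid_stability :
  exists C : R, 0 <= C /\ forall (s m : {ffun V -> R}) (s' m' : V -> R) (e : R),
    fluid_solution P lambda sigma nu s m -> 0 <= e ->
    (forall x, 0 <= m' x) ->
    (forall x, `|s' x - (- m' x + sigma x + inflow P nu m' x)| <= e) ->
    (forall x, `|s' x - stable_density x (inflow P nu m' x)| <= e) ->
    forall x, `|s' x - s x| <= C * e /\ `|m' x - m x| <= C * e.
Proof.
have [w [w0 wP]] := exit_time_supersolution P_irr.
have W0 : 0 <= \sum_x w x by exact: sumr_ge0.
have E0 : 0 <= \sum_x w x * \sum_y P y x.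
  by apply: sumr_ge0 => x _; rewrite mulr_ge0// sumr_ge0.
pose K := 2 * \sum_x w x * \sum_y P y x.
have K0 : 0 <= K by rewrite mulr_ge0.
exists (2 * K + 4); split; first lra.
move=> s m s' m' e sol e0 m'0 h1 h2.
have [_ m0 _ hs] := sol.
pose D x := `|inflow P nu m' x - inflow P nu m x|.
have mD x : `|m' x - m x| <= D x + 2 * e.
  rewrite (fluid_solution_outflow x sol).
  have := outflow_lip x (inflow_ge0 x m'0) (inflow_ge0 x m0).
  have := h1 x; have := h2 x.
  rewrite -/(D x) /outflow.
  rewrite !ler_norml => /andP[? ?] /andP[? ?] /andP[? ?].
  by apply/andP; split; lra.
have DS : \sum_x D x <= K * e.
  have -> : K * e = \sum_x w x * (2 * e * \sum_y P y x).
    rewrite /K mulrAC big_distrr/=.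
    by apply: eq_bigr => x _; ring.
  apply: (@sum_le_supersolution _ _ P) => // [x|x]; first exact: normr_ge0.
  apply: le_trans (inflow_lip m' m x) _.
  rewrite big_distrr/= -big_split/=; apply: ler_sum => y _.
  by rewrite -mulrDl ler_wpM2r.
have Dx x : D x <= K * e.
  by apply: le_trans DS; rewrite (bigD1 x)//= lerDl sumr_ge0// => y _; exact: normr_ge0.
move=> x; split; last first.
  have := mulr_ge0 K0 e0; have := mD x; have := Dx x; lra.
have := outflow_lip x (inflow_ge0 x m'0) (inflow_ge0 x m0).
rewrite -/(D x) /outflow.
have := h2 x; have := hs x; have := Dx x; rewrite -/(stable_density _ _) => h3 ->.
have : `|inflow P nu m' x - inflow P nu m x| <= D x by [].
rewrite !ler_norml => /andP[? ?] /andP[? ?] /andP[? ?].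
by apply/andP; split; lra.
Qed.

End Fluid.

(** * Existence and uniqueness of the fluid solution *)

Section FluidExistence.
Variables (R : realType) (V : finType) (P : V -> V -> R) (lambda sigma nu : V -> R).
Hypothesis P_irr : substochastic_irreducible P.
Hypothesis lambda_ge0 : forall x, 0 <= lambda x.
Hypothesis sigma_01 : forall x, 0 <= sigma x <= 1.
Hypothesis nu_ge0 : forall x, 0 <= nu x.
Hypothesis sigma_le : forall x, sigma x <= lambda x / (1 + lambda x).

Let P_ge0 x y : 0 <= P x y. Proof. by case: P_irr. Qed.
Local Notation outflow := (outflow lambda sigma).

(** Picard iteration from 0 for the inflow equation; it is nondecreasing because [outflow] is. *)
Fixpoint fluid_iter (k : nat) (x : V) : R :=
  if k is k'.+1 then inflow P nu (fun y => outflow y (fluid_iter k' y)) x else 0.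

Lemma fluid_iter_incr k x : 0 <= fluid_iter k x <= fluid_iter k.+1 x.
Proof.
elim: k x => [|k IH] x.
  rewrite lexx/= inflow_ge0// => y.
  by rewrite outflow0.
have h y : 0 <= outflow y (fluid_iter k.+1 y) - outflow y (fluid_iter k y).
  have /andP[h1 h2] := IH y.
  by have /andP[] := outflow_diff lambda_ge0 sigma_01 sigma_le y h1 h2.
apply/andP; split.
  by have /andP[h1 h2] := IH x; exact: le_trans h2.
apply: lerD => //; apply: ler_sum => y _; apply: ler_wpM2r => //.
by rewrite -subr_ge0.
Qed.

(** Since [outflow y i <= i] and the iterates increase, each iterate is a subsolution with source
    [nu], so the supersolution bounds it independently of [k]. *)
Lemma fluid_iter_bounded : exists B, forall k x, fluid_iter k x <= B.
Proof.
have [w [w0 wP]] := exit_time_supersolution P_irr.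
exists (\sum_x w x * nu x) => k x.
have u0 y : 0 <= fluid_iter k y by have /andP[] := fluid_iter_incr k y.
apply: (@le_trans _ _ (\sum_x fluid_iter k x)).
  by rewrite (bigD1 x)//= lerDl sumr_ge0.
apply: (@sum_le_supersolution _ _ P) => // {}x.
have /andP[_ h] := fluid_iter_incr k x; apply: le_trans h _.
rewrite /= /inflow addrC lerD2r; apply: ler_sum => y _; apply: ler_wpM2r => //.
have /andP[_] := outflow_diff lambda_ge0 sigma_01 sigma_le y (lexx 0) (u0 y).
by rewrite outflow0 !subr0.
Qed.

Lemma fluid_fixpoint : exists i : V -> R, (forall x, 0 <= i x) /\
  forall x, i x = inflow P nu (fun y => outflow y (i y)) x.
Proof.
have [B uB] := fluid_iter_bounded.
have mono x : nondecreasing_seq (fun k => fluid_iter k x).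
  by apply/nondecreasing_seqP => k; have /andP[] := fluid_iter_incr k x.
have cv x : cvgn (fun k => fluid_iter k x).
  apply: nondecreasing_is_cvgn; first exact: mono.
  by exists B => _ [k _ <-].
exists (fun x => limn (fun k => fluid_iter k x)); split=> x.
  exact: (nondecreasing_cvgn_le (mono x) (cv x) 0%N).
(* The shifted sequence has the same limit and, by continuity, also converges to the image of the
   limit. *)
have /= := cv x; rewrite -(cvg_shiftS (fun k => fluid_iter k x)) => c1.
apply: (cvg_unique (@Rhausdorff R) c1) => /=.
apply: cvgD; first exact: cvg_cst.
apply: cvg_big => [|y _]; first exact: add_continuous.
apply: cvgM; last exact: cvg_cst.
have ce : (expR (- fluid_iter k y) @[k --> \oo] -->
           expR (- limn (fun k => fluid_iter k y)))%classic.
  apply: continuous_cvg; first exact: continuous_expR.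
  by apply: cvgN; exact: cv.
apply: cvgB; first by apply: cvgD; [exact: cvg_cst | exact: cv].
apply: cvgD; apply: cvgM => //; try exact: cvg_cst.
by apply: cvgB => //; exact: cvg_cst.
Qed.

Lemma fluid_solution_exists_unique :
  exists! sm : {ffun V -> R} * {ffun V -> R},
    fluid_solution P lambda sigma nu sm.1 sm.2.
Proof.
have [i [i0 ie]] := fluid_fixpoint.
pose m := [ffun x => outflow x (i x)].
have inm x : inflow P nu m x = i x.
  rewrite [RHS]ie; congr (_ + _); apply: eq_bigr => y _.
  by rewrite ffunE.
exists ([ffun x => stable_density lambda sigma x (i x)], m); split=> /=.
  split=> x.
  - by rewrite ffunE; exact: stable_density_01.
  - rewrite ffunE.
    have /andP[] := outflow_diff lambda_ge0 sigma_01 sigma_le x (lexx 0) (i0 x).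
    by rewrite outflow0 !subr0.
  - have := inm x; rewrite /inflow => h; rewrite -addrA h !ffunE /outflow; ring.
  - by rewrite inm ffunE.
move=> [s' m'] /= sol.
have [C [_ CP]] := fluid_stability P_irr lambda_ge0 sigma_01 nu_ge0 sigma_le.
have [_ m'0 e1 e2] := sol.
have h x : s' x = stable_density lambda sigma x (i x) /\ m' x = outflow x (i x).
  have m0 y : 0 <= m y.
    rewrite ffunE.
    have /andP[] := outflow_diff lambda_ge0 sigma_01 sigma_le y (lexx 0) (i0 y).
    by rewrite outflow0 !subr0.
  (* Stability with error 0 identifies an arbitrary solution with the constructed one. *)
  have [||h1 h2] := CP s' m' (fun x => stable_density lambda sigma x (i x)) m 0 sol (lexx 0) m0 _ _ x.
  - move=> y; rewrite inm ffunE /outflow normr_le0 subr_eq0; apply/eqP; ring.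
  - by move=> y; rewrite inm subrr normr0.
  have mx : m x = outflow x (i x) by rewrite ffunE.
  move: h1 h2; rewrite mulr0 !normr_le0 !subr_eq0 => /eqP e3 /eqP e4.
  by rewrite -e4 -mx -e3.
by congr (_, _); apply/ffunP => x; rewrite ffunE; have [e3 e4] := h x; rewrite ?e3 ?e4.
Qed.

End FluidExistence.

(** * Absorbed Markov jump processes *)

Section DiscreteMaps.
Variables (R : realType) (d : measure_display) (Omega : measurableType d).
Variables (Pr : probability Omega R) (S : countType).

Lemma measurable_bigcup_count (F : S -> set Omega) :
  (forall z, measurable (F z)) -> measurable (\bigcup_z F z).
Proof. by move=> mF; apply: countable_bigcupT_measurable => //; exact: countableP. Qed.

Lemma negligible_bigcup_count (U : countType) (F : U -> set Omega) :
  (forall z, Pr.-negligible (F z)) -> Pr.-negligible (\bigcup_z F z).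
Proof.
move=> NF; apply: (@negligibleS _ _ _ _ (\bigcup_n if unpickle n is Some z then F z else set0)).
  by move=> w [z _ Fw]; exists (pickle z) => //; rewrite pickleK.
apply: negligible_bigcup => n; case: unpickle => // ; exact: negligible_set0.
Qed.

Variable f : Omega -> S.
Hypothesis mf : forall z, measurable [set w | f w = z].

Lemma measurable_discrete (Q : set S) : measurable [set w | Q (f w)].
Proof.
rewrite (_ : [set w | _] = \bigcup_z [set w | f w = z /\ Q z]).
  apply: measurable_bigcup_count => z; have [Qz|nQz] := pselect (Q z).
    by rewrite (_ : [set w | _] = [set w | f w = z]) //; apply/seteqP; split=> w //= [].
  by rewrite (_ : [set w | _] = set0) //; apply/seteqP; split=> w //= [].
by apply/seteqP; split=> [w /= Qw|w [z _ /= [-> ]]] //; exists (f w).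
Qed.

Lemma probability_seq (A : set Omega) (L : seq S) : measurable A -> uniq L ->
  Pr (A `&` [set w | f w \in L]) = (\sum_(z <- L) Pr (A `&` [set w | f w = z]))%E.
Proof.
move=> mA; elim: L => [_|z L IH /= /andP[zL uL]].
  rewrite big_nil (_ : _ `&` _ = set0) ?measure0//.
  by apply/seteqP; split=> w // [].
rewrite big_cons -IH// -measureU//.
- congr (Pr _); apply/seteqP; split=> w /=.
    by move=> [Aw]; rewrite inE => /orP[/eqP|]; [left|right].
  by move=> [[Aw <-]|[Aw h]]; split=> //; rewrite inE ?eqxx// h orbT.
- exact: measurableI.
- by apply: measurableI => //; exact: (measurable_discrete (fun z => z \in L)).
- by apply/seteqP; split=> w //= [[_ ->] [_]]; rewrite (negPf zL).
Qed.

(** The last premise says that [f] lies in [L] almost surely on [A], so the part of [B] outside [L]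
    is null. This allows conditioning by finite sums although [S] is infinite. *)
Lemma probability_le_seq (A B : set Omega) (L : seq S) :
  measurable A -> measurable B -> uniq L ->
  Pr A = (\sum_(z <- L) Pr (A `&` [set w | f w = z]))%E ->
  (Pr (A `&` B) <= \sum_(z <- L) Pr ((A `&` [set w | f w = z]) `&` B))%E.
Proof.
move=> mA mB uL eA.
have mL : measurable [set w | f w \in L] by exact: (measurable_discrete (fun z => z \in L)).
under eq_bigr do rewrite setIAC.
rewrite -probability_seq//; last exact: measurableI.
rewrite (measureDI Pr (B := [set w | f w \in L]))//; last exact: measurableI.
rewrite -[leRHS]add0e; apply: leeD => //.
rewrite -(_ : Pr (A `\` [set w | f w \in L]) = 0%E).
  apply: le_measure; rewrite ?inE; try apply: measurableD => //; try exact: measurableI.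
  by move=> w [[]].
have -> : Pr (A `\` [set w | f w \in L]) = (Pr A - Pr (A `&` [set w | f w \in L]))%E.
  by apply: measureD => //; rewrite ltey_eq fin_num_measure.
by rewrite probability_seq// -eA subee// fin_num_measure.
Qed.

End DiscreteMaps.

(** * Trajectories and measurability of the final state *)

Section JumpProcess.
Variables (R : realType) (d : measure_display) (Omega : measurableType d).
Variables (Pr : probability Omega R) (S : countType) (E : finType).
Variables (init : S -> R) (rate : S -> E -> R) (step : S -> E -> S).
Variables (Y : nat -> Omega -> S) (T : nat -> Omega -> \bar R) (zd : S).
Hypothesis rate_ge0 : forall z e, 0 <= rate z e.
Hypothesis mjp : markov_jump_process Pr init rate step Y T.

Let mY i z : measurable [set w | Y i w = z]. Proof. by case: mjp. Qed.
Let mT i : measurable_fun setT (T i). Proof. by case: mjp. Qed.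
Let T_gt0 i w : (0 < T i w)%E. Proof. by case: mjp. Qed.

Local Notation er := (exit_rate rate).
Local Notation jp := (jump_prob rate step).

Lemma exit_rate_ge0 z : 0 <= er z.
Proof. by apply: sumr_ge0 => e _. Qed.

Lemma jump_timeS k w : jump_time T k.+1 w = (jump_time T k w + T k w)%E.
Proof. by rewrite /jump_time big_ord_recr. Qed.

Lemma jump_time_le k l w : (k <= l)%N -> (jump_time T k w <= jump_time T l w)%E.
Proof.
move=> /subnK <-; elim: (l - k)%N => [//|j IH].
by rewrite addSn jump_timeS (le_trans IH)// leeDl// ltW.
Qed.

Lemma jump_time0 w : jump_time T 0 w = 0%E.
Proof. by rewrite /jump_time big_ord0. Qed.

Definition covers (t : R) (w : Omega) (k : nat) :=
  (jump_time T k w <= t%:E < jump_time T k.+1 w)%E.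

Lemma covers_uniq t w k l : covers t w k -> covers t w l -> k = l.
Proof.
wlog kl : k l / (k < l)%N.
  move=> h hk hl; have [kl|lk|//] := ltngtP k l; first exact: h.
  by apply/esym; exact: h.
move=> /andP[_ h1] /andP[h2 _]; exfalso.
have := lt_le_trans h1 (jump_time_le w kl).
by move=> /lt_le_trans/(_ h2); rewrite ltxx.
Qed.

Lemma state_at_covers t w k : covers t w k -> state_at Y T t w = Some (Y k w).
Proof.
move=> ck; apply: xget_unique; first by exists k.
by move=> _ [l /= cl <-]; rewrite (covers_uniq ck cl).
Qed.

Lemma state_atP t w z :
  state_at Y T t w = Some z <-> exists2 k, covers t w k & Y k w = z.
Proof.
split=> [|[k ck <-]]; last exact: state_at_covers.
rewrite /state_at; case: xgetP => // o -> [k /= ck <-] [<-].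
by exists k.
Qed.

Lemma measurable_jump_time k : measurable_fun setT (jump_time T k).
Proof. by apply: emeasurable_sum => i; exact: mT. Qed.

Lemma measurable_state_at t z : measurable [set w | state_at Y T t w = Some z].
Proof.
rewrite (_ : [set w | _] = \bigcup_k ([set w | covers t w k] `&` [set w | Y k w = z])).
  apply: bigcupT_measurable => k; apply: measurableI => //.
  rewrite (_ : [set w | _] = [set w | (jump_time T k w <= t%:E)%E] `&`
                             [set w | (t%:E < jump_time T k.+1 w)%E]).
    apply: measurableI; rewrite -[X in measurable X]setTI.
      by apply: emeasurable_fun_infty_c => //; exact: measurable_jump_time.
    by apply: emeasurable_fun_o_infty => //; exact: measurable_jump_time.
  by apply/seteqP; split=> w /=; rewrite /covers => /andP.
apply/seteqP; split=> w /=; first by move=> /state_atP[k ck e]; exists k.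
by move=> [k _ [ck e]]; apply/state_atP; exists k.
Qed.

Definition eventually_at (z : S) (w : Omega) :=
  exists t0 : R, forall t : R, 0 <= t -> t0 <= t -> state_at Y T t w = Some z.

(* Rational times suffice, since a trajectory is right-continuous up to its
   possible explosion. *)
Lemma eventually_at_rat z w : eventually_at z w <->
  exists m : nat, forall q : rat, m%:R <= ratr q :> R ->
    state_at Y T (ratr q) w = Some z.
Proof.
split=> [[t0 h]|[m h]].
  have [m t0m] : exists m : nat, t0 <= m%:R.
    exists (Num.truncn t0).+1; exact/ltW/archimedean.Num.Theory.truncnS_gt.
  exists m => q mq; apply: h; first exact: le_trans mq.
  exact: le_trans mq.
exists m%:R => t t0 mt.
(* If [t] lies in a holding interval, a rational slightly larger than [t] lies in the same one and
   shows the same state. *)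
suff [k ck] : exists k, covers t w k.
  have /andP[h1 h2] := ck.
  have [u tu uJ] : exists2 u : R, t < u & (u%:E <= jump_time T k.+1 w)%E.
    move: h2; case: (jump_time T k.+1 w) => [r|_|//].
      by rewrite lte_fin => tr; exists r.
    by exists (t + 1); rewrite ?ltrDl ?leey.
  have [q] := rat_in_itvoo tu; rewrite in_itv/= => /andP[tq qu].
  have cq : covers (ratr q) w k.
    apply/andP; split; first by apply: le_trans h1 _; rewrite lee_fin ltW.
    by apply: lt_le_trans uJ; rewrite lte_fin.
  rewrite (state_at_covers ck) -(state_at_covers cq).
  by apply: h; apply: le_trans mt _; exact: ltW.
(* A rational beyond [t] is covered, so [t] precedes any explosion; the first jump after [t] closes
   the interval containing [t]. *)
have t1 : t < t + 1 by rewrite ltrDl.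
have [q] := rat_in_itvoo t1; rewrite in_itv/= => /andP[tq _].
have /state_atP[k /andP[_ qk] _] := h q (ltW (le_lt_trans mt tq)).
have ex : exists k, (t%:E < jump_time T k.+1 w)%E.
  by exists k; apply: lt_trans qk; rewrite lte_fin.
case: (ex_minnP ex) => j tj jmin; exists j; rewrite /covers tj andbT.
case: j => [|j] in tj jmin *; first by rewrite jump_time0 lee_fin.
by rewrite leNgt; apply/negP => /jmin; rewrite ltnn.
Qed.

Lemma measurable_eventually_at z : measurable [set w | eventually_at z w].
Proof.
rewrite (_ : [set w | _] = \bigcup_m ~` \bigcup_(q : rat)
    [set w | m%:R <= ratr q :> R /\ ~ state_at Y T (ratr q) w = Some z]).
  apply: bigcupT_measurable => m; apply: measurableC.
  apply: bigcupT_measurable_rat => q; have [mq|mq] := boolP (m%:R <= ratr q :> R).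
    rewrite (_ : [set w | _] = ~` [set w | state_at Y T (ratr q) w = Some z]).
      by apply: measurableC; exact: measurable_state_at.
    by apply/seteqP; split=> w //= [].
  by rewrite (_ : [set w | _] = set0)//; apply/seteqP; split=> w //= [].
apply/seteqP; split=> w /=.
  move=> /eventually_at_rat[m h]; exists m => // -[q _ [mq]]; apply; exact: h.
move=> [m _ h]; apply/eventually_at_rat; exists m => q mq.
by apply: contrapT => nh; apply: h; exists q.
Qed.

Lemma eventually_at_uniq z z' w : eventually_at z w -> eventually_at z' w -> z = z'.
Proof.
move=> [t h] [t' h']; pose u := Num.max 0 (Num.max t t').
have u0 : 0 <= u by rewrite /u le_max lexx.
have tu : t <= u by rewrite /u !le_max lexx !orbT.
have tu' : t' <= u by rewrite /u !le_max lexx !orbT.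
by have := h u u0 tu; rewrite h'// => -[].
Qed.

Lemma final_state_eventually z w : eventually_at z w -> final_state zd Y T w = z.
Proof.
by move=> h; apply: xget_unique => // z' h'; exact: eventually_at_uniq h' h.
Qed.

Lemma measurable_final_state z : measurable [set w | final_state zd Y T w = z].
Proof.
(* The default [zd] also collects the trajectories without an eventual state. *)
have -> : [set w | final_state zd Y T w = z] =
    [set w | eventually_at z w] `|`
    ((~` \bigcup_z' [set w | eventually_at z' w]) `&` [set w | zd = z]).
  apply/seteqP; split=> w /=.
    rewrite /final_state; case: xgetP => [z' -> h <-|h e]; first by left.
    by right; split=> // -[z' _ /h].
  move=> [/final_state_eventually//|[h <-]].
  by apply: xgetPN => z' h'; apply: h; exists z'.
apply: measurableU; first exact: measurable_eventually_at.
apply: measurableI.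
  by apply/measurableC/measurable_bigcup_count => z'; exact: measurable_eventually_at.
have [e|ne] := pselect (zd = z).
  by rewrite (_ : [set w | _] = setT)//; apply/seteqP; split.
by rewrite (_ : [set w | _] = set0)//; apply/seteqP; split.
Qed.

End JumpProcess.

(** * Law of the jump chain and of the holding times *)

Section JumpProcessLaw.
Variables (R : realType) (d : measure_display) (Omega : measurableType d).
Variables (Pr : probability Omega R) (S : countType) (E : finType).
Variables (init : S -> R) (rate : S -> E -> R) (step : S -> E -> S).
Variables (Y : nat -> Omega -> S) (T : nat -> Omega -> \bar R) (zd : S).
Hypothesis rate_ge0 : forall z e, 0 <= rate z e.
Hypothesis mjp : markov_jump_process Pr init rate step Y T.

Let mY i z : measurable [set w | Y i w = z]. Proof. by case: mjp. Qed.
Let mT i : measurable_fun setT (T i). Proof. by case: mjp. Qed.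
Let T_gt0 i w : (0 < T i w)%E. Proof. by case: mjp. Qed.

Local Notation er := (exit_rate rate).
Local Notation jp := (jump_prob rate step).

Definition prefix (z : nat -> S) (k : nat) :=
  [set w | forall i, (i <= k)%N -> Y i w = z i].

Definition weight (z : nat -> S) (k : nat) : R :=
  init (z 0%N) * \prod_(i < k) jp (z i) (z i.+1).

Lemma prefixS z k : prefix z k.+1 = prefix z k `&` [set w | Y k.+1 w = z k.+1].
Proof.
apply/seteqP; split=> w /=.
  by move=> h; split=> [i ik|]; apply: h => //; exact: leqW.
by move=> [h e] i; rewrite leq_eqVlt => /orP[/eqP ->//|ik]; exact: h.
Qed.

Lemma prefix0 z : prefix z 0 = [set w | Y 0 w = z 0%N].
Proof.
by apply/seteqP; split=> [w h|w /= h i]; [exact: h | rewrite leqn0 => /eqP ->].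
Qed.

Lemma measurable_prefix z k : measurable (prefix z k).
Proof.
elim: k => [|k IH]; first by rewrite prefix0.
by rewrite prefixS; exact: measurableI.
Qed.

Lemma measurable_holding i (t : R) : measurable [set w | (t%:E < T i w)%E].
Proof.
by rewrite -[X in measurable X]setTI; apply: emeasurable_fun_o_infty.
Qed.

Lemma probability_prefix_holding z k t : 0 <= t ->
  Pr (prefix z k `&` [set w | (t%:E < T k w)%E]) =
  (weight z k * expR (- (er (z k) * t)))%:E.
Proof.
move=> t0; have [_ _ _ law] := mjp.
(* Thresholds 0 before [k] impose nothing, as holding times are positive, and contribute factors
   1. *)
have := law k z (fun i => if i == k then t else 0).
rewrite (_ : [set w | _] = prefix z k `&` [set w | (t%:E < T k w)%E]); last first.
  apply/seteqP; split=> w /=.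
    move=> h; split; first by move=> i /h[].
    by have [//|_] := h k; rewrite eqxx.
  by move=> [h1 h2] i ik; split; [exact: h1 | case: eqP => [->//|_]].
move=> ->; last by move=> i; case: ifP.
rewrite -/(weight z k); congr ((_ * _)%:E).
rewrite big_ord_recr/= eqxx big1 ?mul1r// => i _.
by rewrite ltn_eqF// mulr0 oppr0 expR0.
Qed.

Lemma probability_prefix z k : Pr (prefix z k) = (weight z k)%:E.
Proof.
have := probability_prefix_holding z k (lexx 0).
rewrite mulr0 oppr0 expR0 mulr1 => <-; congr (Pr _).
by apply/seteqP; split=> w //= [].
Qed.

(** There are countably many finite trajectories, so nullity can be checked on each; [zd] only pads
    the sequences. *)
Lemma negligible_prefix (B : set Omega) k :
  (forall z, Pr.-negligible (B `&` prefix z k)) -> Pr.-negligible B.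
Proof.
move=> h; apply: (@negligibleS _ _ _ _ (\bigcup_(s : seq S) (B `&` prefix (nth zd s) k))).
  move=> w Bw; exists (mkseq (Y^~ w) k.+1) => //; split=> // i ik.
  by rewrite nth_mkseq.
by apply: negligible_bigcup_count => s; exact: h.
Qed.

Lemma negligible_infinite_holding k :
  Pr.-negligible [set w | er (Y k w) != 0 /\ T k w = +oo%E].
Proof.
apply: (negligible_prefix (k := k)) => z.
have mI : measurable (prefix z k `&` [set w | T k w = +oo%E]).
  apply: measurableI; first exact: measurable_prefix.
  rewrite (_ : [set w | _] = \bigcap_n [set w | (n%:R%:E < T k w)%E]).
    by apply: bigcapT_measurable => n; exact: measurable_holding.
  apply/seteqP; split=> w /=; first by move=> e n _ /=; rewrite e ltry.
  move=> h; apply/eqyP => r r0.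
  have := h (Num.truncn r).+1 I => /= h'; apply: le_trans (ltW h').
  by rewrite lee_fin; exact/ltW/archimedean.Num.Theory.truncnS_gt.
have [e0|ne0] := eqVneq (er (z k)) 0.
  rewrite (_ : _ `&` _ = set0); first exact: negligible_set0.
  apply/seteqP; split=> w //= [[+ _] h].
  by rewrite h// e0 eqxx.
apply: (@negligibleS _ _ _ _ (prefix z k `&` [set w | T k w = +oo%E])).
  by move=> w [[_ h1] h2].
apply/negligibleP => //.
have r0 : 0 < er (z k) by rewrite lt0r ne0 exit_rate_ge0.
apply/eqP; rewrite eq_le measure_ge0 andbT.
apply/lee_addgt0Pr => eps eps0; rewrite add0e.
pose W := weight z k.
have W0 : 0 <= W by rewrite -lee_fin -probability_prefix.
(* With this time the exponent is [W / eps], and [W * expR (- (W / eps)) <= eps] because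
   [expR u >= 1 + u]. *)
pose t := W / (er (z k) * eps).
have t0 : 0 <= t by rewrite divr_ge0// mulr_ge0// ltW.
apply: le_trans (le_trans (_ : (_ <= Pr (prefix z k `&` [set w | (t%:E < T k w)%E]))%E) _).
- exact: lexx.
- apply: le_measure; rewrite ?inE//.
    by apply: measurableI; [exact: measurable_prefix|exact: measurable_holding].
  by move=> w /= [h ->]; split=> //; exact: ltry.
rewrite probability_prefix_holding// lee_fin -/W.
have e1 : er (z k) * t = W / eps by rewrite /t; field; rewrite ne0 gt_eqF.
rewrite e1 expRN ler_pdivrMr ?expR_gt0//.
have := expR_ge1Dx (W / eps) => h.
apply: (@le_trans _ _ (eps * (1 + W / eps))); last by rewrite ler_pM2l.
by rewrite mulrDr mulrCA divff ?gt_eqF// !mulr1 lerDr ltW.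
Qed.

(** At rate 0 the law gives [T k > n] the full mass of the prefix for every [n]. *)
Lemma negligible_finite_holding k :
  Pr.-negligible [set w | er (Y k w) = 0 /\ T k w != +oo%E].
Proof.
apply: (negligible_prefix (k := k)) => z.
have [e0|ne0] := pselect (er (z k) = 0); last first.
  rewrite (_ : _ `&` _ = set0); first exact: negligible_set0.
  by apply/seteqP; split=> w //= [[+ _] h]; rewrite h.
apply: (@negligibleS _ _ _ _ (\bigcup_n (prefix z k `\` [set w | (n%:R%:E < T k w)%E]))).
  move=> w /= [[_ hT] h]; have := T_gt0 k w; case e: (T k w) hT => [r| |] // _ _.
  exists (Num.truncn r).+1 => //; split=> //=; apply/negP; rewrite -leNgt e lee_fin.
  exact/ltW/archimedean.Num.Theory.truncnS_gt.
apply: negligible_bigcup => n; apply/negligibleP.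
  by apply: measurableD; [exact: measurable_prefix|exact: measurable_holding].
have e : Pr (prefix z k `\` [set w | (n%:R%:E < T k w)%E]) =
   (Pr (prefix z k) - Pr (prefix z k `&` [set w | (n%:R%:E < T k w)%E]))%E.
  apply: measureD; [exact: measurable_prefix|exact: measurable_holding|].
  by rewrite ltey_eq fin_num_measure//; exact: measurable_prefix.
apply: etrans e _; rewrite probability_prefix_holding// probability_prefix e0 mul0r oppr0 expR0 mulr1.
by rewrite -EFinB subrr.
Qed.

Lemma negligible_leave_absorbing k :
  Pr.-negligible [set w | er (Y k w) = 0 /\ Y k.+1 w <> Y k w].
Proof.
apply: (negligible_prefix (k := k.+1)) => z.
have [[e0 ne]|nh] := pselect (er (z k) = 0 /\ z k.+1 <> z k); last first.
  rewrite (_ : _ `&` _ = set0); first exact: negligible_set0.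
  by apply/seteqP; split=> w //= [[]] + + h; rewrite !h// => a b; apply: nh.
apply: (@negligibleS _ _ _ _ (prefix z k.+1)); first by move=> w [].
apply/negligibleP; first exact: measurable_prefix.
apply: etrans (probability_prefix _ _) _.
rewrite /weight big_ord_recr/= /jump_prob e0 eqxx.
by rewrite (negPf (introN eqP (nesym ne))) !mulr0.
Qed.

(** Off the three null sets above, an infinite holding time is the same as exit rate 0, and the
    chain stays constant once absorbed. *)
Lemma final_state_absorbing : exists2 N : set Omega, Pr.-negligible N &
  forall k w, ~ N w -> er (Y k w) = 0 -> final_state zd Y T w = Y k w.
Proof.
exists ((\bigcup_k [set w | er (Y k w) != 0 /\ T k w = +oo%E]) `|`
  (\bigcup_k [set w | er (Y k w) = 0 /\ T k w != +oo%E]) `|`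
  (\bigcup_k [set w | er (Y k w) = 0 /\ Y k.+1 w <> Y k w])).
  apply: negligibleU; first apply: negligibleU; apply: negligible_bigcup => k.
  - exact: negligible_infinite_holding.
  - exact: negligible_finite_holding.
  - exact: negligible_leave_absorbing.
move=> k w nN e0.
have N1 j : T j w = +oo%E -> er (Y j w) = 0.
  move=> Tj; apply: contrapT => /eqP ne; apply: nN; left; left; by exists j.
have N2 j : er (Y j w) = 0 -> T j w = +oo%E.
  move=> ej; apply: contrapT => /eqP ne; apply: nN; left; right; by exists j.
have N3 j : er (Y j w) = 0 -> Y j.+1 w = Y j w.
  by move=> ej; apply: contrapT => ne; apply: nN; right; exists j.
have ex : exists j, T j w == +oo%E by exists k; rewrite N2.
(* Minimality of [j] makes all earlier holding times finite, so the state [Y j w] is entered at a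
   finite time and kept forever. *)
case: (ex_minnP ex) => j /eqP Tj jmin.
have jk : (j <= k)%N by apply: jmin; rewrite N2.
have YD i : Y (j + i)%N w = Y j w /\ er (Y (j + i)%N w) = 0.
  elim: i => [|i [IH1 IH2]]; first by rewrite addn0; split=> //; exact: N1.
  by rewrite addnS N3// IH1; split=> //; exact: N1.
have -> : Y k w = Y j w by rewrite -(subnKC jk); have [] := YD (k - j)%N.
apply: final_state_eventually.
have finJ i : (i <= j)%N -> jump_time T i w \is a fin_num.
  elim: i => [|i IH] ij; first by rewrite jump_time0.
  have Tfin : T i w \is a fin_num.
    rewrite ge0_fin_numE; last exact/ltW/T_gt0.
    rewrite ltey; apply/negP => Ti.
    by have := jmin _ Ti; rewrite leqNgt ij.
  by rewrite jump_timeS fin_numD Tfin (IH (ltnW ij)).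
exists (fine (jump_time T j w)) => t t0 jt.
apply: (state_at_covers mjp); apply/andP; split.
  by rewrite -(fineK (finJ j (leqnn j))) lee_fin.
by rewrite jump_timeS Tj addey ?ltry// -ltNye ltNye_eq finJ.
Qed.

(** Transition operator of the jump chain, written as a sum over transitions rather than over target
    states. *)
Definition jump_op (h : S -> R) (z : S) : R :=
  if er z == 0 then h z else (\sum_e rate z e * h (step z e)) / er z.

(** Integration against the image of the weights [p] under [c]; it serves for the jump kernel and
    for the initial law. *)
Lemma sum_undup_fibers (I : finType) (c : I -> S) (p : I -> R) (h : S -> R)
    (L : seq S) : uniq L -> (forall i, c i \in L) ->
  \sum_(z <- L) (\sum_(i | c i == z) p i) * h z = \sum_i p i * h (c i).
Proof.
move=> uL cL; under eq_bigr do rewrite big_distrl/= big_mkcond/=.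
rewrite exchange_big/=; apply: eq_bigr => i _.
rewrite (bigD1_seq (c i))//= eqxx big1 ?addr0// => z.
by rewrite eq_sym => /negPf ->.
Qed.

Lemma sum_jump_prob z h (L : seq S) : uniq L -> z \in L ->
  (forall e, step z e \in L) -> \sum_(z' <- L) jp z z' * h z' = jump_op h z.
Proof.
move=> uL zL eL; rewrite /jump_prob /jump_op; case: eqP => [_|_].
  rewrite (bigD1_seq z)//= eqxx mul1r big1 ?addr0// => z'.
  by rewrite eq_sym => /negPf ->; rewrite mul0r.
rewrite -(sum_undup_fibers _ _ uL eL) big_distrl/=; apply: eq_bigr => z' _.
by rewrite mulrAC.
Qed.

Lemma jump_op1 z : jump_op (fun=> 1) z = 1.
Proof.
rewrite /jump_op; case: eqVneq => // ne; under eq_bigr do rewrite mulr1.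
by rewrite divff.
Qed.

Lemma jump_op_le h h' z : (forall z', h z' <= h' z') -> jump_op h z <= jump_op h' z.
Proof.
move=> hh; rewrite /jump_op; case: ifP => // _.
apply: ler_wpM2r; first by rewrite invr_ge0; exact: exit_rate_ge0.
by apply: ler_sum => e _; rewrite ler_wpM2l.
Qed.

(** Backward equation for the probability that the jump chain from [z] is in [B] at step [m]
    exactly, not for a first hitting time. *)
Fixpoint hitting_prob (B : pred S) (m : nat) : S -> R :=
  if m is m'.+1 then jump_op (hitting_prob B m') else fun z => (B z)%:R.

(** Markov property by induction on [m], splitting according to the state at step [j.+1]. *)
Lemma probability_prefix_hit (B : pred S) m z j :
  (Pr (prefix z j `&` [set w | B (Y (j + m)%N w)]) <=
   (weight z j * hitting_prob B m (z j))%:E)%E.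
Proof.
have mB i : measurable [set w | B (Y i w)] by exact: (measurable_discrete (mY i) [set z | B z]).
elim: m z j => [|m IH] z j.
  rewrite addn0 /=; case: (boolP (B (z j))) => Bz.
    rewrite mulr1 -probability_prefix; apply: le_measure; rewrite ?inE.
    - by apply: measurableI => //; exact: measurable_prefix.
    - exact: measurable_prefix.
    - by move=> w [].
  rewrite mulr0 (_ : _ `&` _ = set0) ?measure0//.
  by apply/seteqP; split=> w //= [h]; rewrite h// (negPf Bz).
pose upd z' := fun i => if (i <= j)%N then z i else z'.
have updE z' : prefix z j `&` [set w | Y j.+1 w = z'] = prefix (upd z') j.+1.
  rewrite prefixS /upd ltnn; congr (_ `&` _); apply/seteqP.
  by split=> w /= h i ij; have := h i ij; rewrite ij.
have updW z' : weight (upd z') j.+1 = weight z j * jp (z j) z'.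
  rewrite /weight big_ord_recr/= /upd leqnn ltnn mulrA; congr (_ * _ * _).
  by apply: eq_bigr => i _; rewrite /= ltn_ord ltnW.
(* The current state belongs to the list since an absorbing state jumps to itself. *)
pose L := undup (z j :: [seq step (z j) e | e <- enum E]).
have uL : uniq L by exact: undup_uniq.
have zL : z j \in L by rewrite mem_undup inE eqxx.
have eL e : step (z j) e \in L.
  by rewrite mem_undup inE map_f ?orbT// mem_enum.
have := @probability_le_seq _ _ _ Pr _ (Y j.+1) (mY j.+1) (prefix z j)
   [set w | B (Y (j + m.+1)%N w)] L (measurable_prefix z j) (mB _) uL.
move=> le1; apply: le_trans (le1 _) _ => {le1}.
  (* The list exhausts the mass of the prefix because the jump probabilities sum to 1. *)
  under eq_bigr do rewrite updE probability_prefix updW.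
  rewrite probability_prefix sumEFin; congr (_%:E).
  rewrite -big_distrr/= -[LHS]mulr1; congr (_ * _).
  rewrite -(jump_op1 (z j)) -(sum_jump_prob _ uL zL eL).
  by apply: eq_bigr => z' _; rewrite mulr1.
rewrite [hitting_prob _ _.+1]/= -(sum_jump_prob _ uL zL eL) big_distrr/= -sumEFin.
apply: lee_sum => z' _; rewrite updE mulrA -updW addnS -addSn.
by have := IH (upd z') j.+1; rewrite {3}/upd ltnn.
Qed.

End JumpProcessLaw.

(* The cardinals in [Defs] are those of classical sets. *)
Lemma card_mkset (T : finType) (b : pred T) : #|[set x | b x]| = #|b|.
Proof.
by apply: eq_card => x; apply/idP/idP => [/set_mem//|h]; exact: mem_set.
Qed.

(** * Bounding the law of the final state by supermartingales *)

Section FinalState.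
Variables (R : realType) (d : measure_display) (Omega : measurableType d).
Variables (Pr : probability Omega R) (S : countType) (E I : finType).
Variables (init : S -> R) (rate : S -> E -> R) (step : S -> E -> S) (c : I -> S).
Variables (Y : nat -> Omega -> S) (T : nat -> Omega -> \bar R) (zd : S).
Hypothesis rate_ge0 : forall z e, 0 <= rate z e.
Hypothesis I_gt0 : (0 < #|I|)%N.
Hypothesis initE : forall z, init z = #|[set i | z == c i]|%:R / #|I|%:R.
Hypothesis mjp : markov_jump_process Pr init rate step Y T.

Let mY i z : measurable [set w | Y i w = z]. Proof. by case: mjp. Qed.
Local Notation er := (exit_rate rate).
Local Notation mean h := ((\sum_i h (c i)) / #|I|%:R).

Lemma probability_hit_le (B : pred S) m :
  (Pr [set w | B (Y m w)] <= (mean (hitting_prob rate step B m))%:E)%E.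
Proof.
have mB : measurable [set w | B (Y m w)] by exact: (measurable_discrete (mY m) [set z | B z]).
pose L := undup [seq c i | i <- enum I].
have uL : uniq L by exact: undup_uniq.
have cL i : c i \in L by rewrite mem_undup map_f ?mem_enum.
have I0 : #|I|%:R != 0 :> R by rewrite pnatr_eq0 -lt0n.
have initS z : init z = \sum_(i | c i == z) #|I|%:R^-1.
  rewrite initE sumr_const -[RHS]mulr_natl; congr (_ * _); congr (_%:R).
  by rewrite card_mkset; apply: eq_card => i; rewrite -!topredE /= eq_sym.
have P0 z : Pr (setT `&` [set w | Y 0 w = z]) = (init z)%:E.
  rewrite setTI -(prefix0 Y (fun=> z)) (probability_prefix mjp).
  by rewrite /weight big_ord0 mulr1.
rewrite -[X in Pr X]setTI.
apply: le_trans (@probability_le_seq _ _ _ Pr _ (Y 0%N) (mY 0%N) setT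
   [set w | B (Y m w)] L _ mB uL _) _ => //.
  under eq_bigr do rewrite P0.
  rewrite sumEFin probability_setT; congr (_%:E).
  under eq_bigr do rewrite -[init _]mulr1 initS.
  rewrite (sum_undup_fibers _ (fun=> 1) uL cL).
  under eq_bigr do rewrite mulr1.
  by rewrite sumr_const -[RHS]mulr_natl divff.
rewrite big_distrl/=.
under [X in (_ <= X%:E)%E]eq_bigr do rewrite mulrC.
rewrite -(sum_undup_fibers _ _ uL cL) -sumEFin; apply: lee_sum => z _.
rewrite -initS setTI -(prefix0 Y (fun=> z)).
have := probability_prefix_hit mjp B m (fun=> z) 0.
by rewrite /weight big_ord0 mulr1.
Qed.

Variables (G V : S -> R) (Q : pred S).
Hypothesis G_ge0 : forall z, 0 <= G z.
Hypothesis V_ge0 : forall z, 0 <= V z.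
Hypothesis G_super : forall z, \sum_e rate z e * (G (step z e) - G z) <= 0.
Hypothesis V_super : forall z, \sum_e rate z e * (V (step z e) - V z) <= - er z.
Hypothesis Q_le : forall z, er z = 0 -> Q z -> 1 <= G z.

(** The failures at a given step: not yet absorbed, or in [Q]. *)
Let B : pred S := fun z => (er z != 0) || Q z.

Lemma hitting_prob_absorbing m z : er z = 0 -> hitting_prob rate step B m z = (B z)%:R.
Proof. by move=> e0; elim: m => [//|m IH] /=; rewrite /jump_op e0 eqxx. Qed.

Lemma hitting_prob_le1 m z : hitting_prob rate step B m z <= 1.
Proof.
elim: m z => [|m IH] z /=; first by case: (B z); rewrite ?ler01 ?lexx.
by rewrite -(jump_op1 rate step z); exact: jump_op_le.
Qed.

(* [V] controls the total time spent off the absorbing states, so that the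
   probability not to be absorbed at time [m] is at most [V / m]. *)
Lemma hitting_prob_supersolution m z :
  m%:R * hitting_prob rate step B m z <= m%:R * G z + V z.
Proof.
elim: m z => [|m IH] z; first by rewrite !mul0r add0r.
have [e0|ne0] := eqVneq (er z) 0.
  rewrite hitting_prob_absorbing// /B e0 eqxx/=.
  have := Q_le e0; have := G_ge0 z; have := V_ge0 z; have := ler0n R m.+1.
  case: (Q z) => [m0 V0 G0 /(_ isT)|m0 V0 G0 _]; rewrite ?mulr1 ?mulr0; last nra.
  by nra.
have er0 : 0 < er z by rewrite lt0r ne0 exit_rate_ge0.
have h1 := hitting_prob_le1 m.+1 z.
(* The unit gained from the drift of [V] pays for passing from [m] to [m.+1], since the probability
   is at most 1. *)
suff h2 : m%:R * hitting_prob rate step B m.+1 z <= m%:R * G z + V z - 1.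
  by rewrite -natr1 !mulrDl !mul1r; have := G_ge0 z; lra.
rewrite /= /jump_op (negPf ne0) mulrA ler_pdivrMr// big_distrr/=.
apply: (@le_trans _ _ (\sum_e rate z e * (m%:R * G (step z e) + V (step z e)))).
  by apply: ler_sum => e _; rewrite mulrCA ler_wpM2l.
have -> : \sum_e rate z e * (m%:R * G (step z e) + V (step z e)) =
    m%:R * (\sum_e rate z e * (G (step z e) - G z)) +
    \sum_e rate z e * (V (step z e) - V z) + (m%:R * G z + V z) * er z.
  rewrite /exit_rate !big_distrr/= -!big_split/=; apply: eq_bigr => e _; ring.
have := V_super z; have := G_super z; have := ler0n R m; nra.
Qed.

Lemma measurable_final_event :
  measurable [set w | Q (final_state zd Y T w)].
Proof.
apply: (measurable_discrete _ [set z | Q z]) => z.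
exact: (measurable_final_state zd mjp).
Qed.

(** If the final state is in [Q] then, off a null set, [B] holds at every step [m]; this has
    probability at most [mean G + mean V / m], and [m] is arbitrary. *)
Lemma probability_final_state_le :
  (Pr [set w | Q (final_state zd Y T w)] <= (mean G)%:E)%E.
Proof.
have I0 : 0 < #|I|%:R :> R by rewrite ltr0n.
have mV0 : 0 <= mean V by rewrite divr_ge0// ?sumr_ge0 ?ltW.
have mF := measurable_final_event.
have mB m : measurable [set w | B (Y m w)] by exact: (measurable_discrete (mY m) [set z | B z]).
have [N NN NP] := final_state_absorbing zd rate_ge0 mjp.
have [N' [mN' N'0 NN']] := NN.
have le1 m : (Pr [set w | Q (final_state zd Y T w)] <= Pr [set w | B (Y m w)])%E.
  apply: (@le_trans _ _ (Pr ([set w | B (Y m w)] `|` N'))).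
    apply: le_measure; rewrite ?inE//; first exact: measurableU.
    move=> w /= Qw; have [Nw|nNw] := pselect (N w); [by right; exact: NN'|left].
    rewrite /B; case: eqVneq => //= e0; rewrite (NP m) // in Qw.
  apply: le_trans (measureU2 _ _ _) _ => //.
  by rewrite [X in (_ + X)%E]N'0 adde0.
apply/lee_addgt0Pr => eps eps0; rewrite -EFinD.
pose m := (Num.truncn (mean V / eps)).+1.
have m0 : 0 < m%:R :> R by rewrite ltr0n.
apply: le_trans (le1 m) _; apply: le_trans (probability_hit_le B m) _.
rewrite lee_fin -(ler_pM2l m0).
apply: (@le_trans _ _ (m%:R * mean G + mean V)); last first.
  rewrite mulrDr lerD2l -ler_pdivrMr//.
  exact/ltW/archimedean.Num.Theory.truncnS_gt.
rewrite !mulrA -mulrDl ler_pM2r ?invr_gt0// !big_distrr/= -big_split/=.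
by apply: ler_sum => i _; exact: hitting_prob_supersolution.
Qed.

End FinalState.

(** * Generator of the village model *)

Lemma big_option (R : nmodType) (T : finType) (F : option T -> R) :
  \sum_o F o = F None + \sum_t F (Some t).
Proof.
rewrite (bigD1 None)//=; congr (_ + _).
rewrite (reindex_omap Some id) => [|[t|]//].
by apply: eq_bigl => t; rewrite eqxx.
Qed.

Section Generator.
Variables (R : realType) (V : finType) (P : V -> V -> R) (lambda : V -> R) (n : nat).
Hypothesis P_ge0 : forall x y, 0 <= P x y.
Hypothesis P_le1 : forall x, \sum_y P x y <= 1.
Hypothesis lambda_ge0 : forall x, 0 <= lambda x.
Hypothesis n_gt0 : (0 < n)%N.

Local Notation state := (varw_state V n).
Local Notation rate := (@varw_rate R V P lambda n).
Local Notation step := (@varw_step V n).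
Local Notation act z h := ((active_at z.1 h)%:R : R).

Definition sleep_rate (z : state) (h : house V n) : R :=
  if z.1 h == Some 1%N then lambda h.1 else 0.

(* Mean value of [f] over the destination of a particle jumping from [h]. *)
Definition jump_mean (h : house V n) (f : option (house V n) -> R) : R :=
  \sum_h' P h.1 h'.1 / n%:R * f (Some h') + (1 - \sum_y P h.1 y) * f None.

(** Every generator computation starts from this split into jumps and falls asleep. *)
Lemma sum_rate (z : state) (f : varw_event V n -> R) :
  \sum_e rate z e * f e =
  \sum_h act z h * jump_mean h (fun o => f (inl (h, o))) +
  \sum_h sleep_rate z h * f (inr h).
Proof.
rewrite big_sumType/=; congr (_ + _).
transitivity (\sum_h \sum_o rate z (inl (h, o)) * f (inl (h, o))).
  by rewrite pair_bigA; apply: eq_bigr => -[].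
apply: eq_bigr => h _; rewrite big_option /jump_mean mulrDr addrC big_distrr/=.
by congr (_ + _); [apply: eq_bigr => h' _|]; rewrite -!mulrA.
Qed.

Lemma sum_house_mean x (g : V -> R) :
  \sum_(h' : house V n) P x h'.1 / n%:R * g h'.1 = \sum_y P x y * g y.
Proof.
rewrite -(pair_bigA _ (fun y (i : 'I_n) => P x y / n%:R * g y))/=.
apply: eq_bigr => y _; rewrite sumr_const card_ord -[LHS]mulr_natl; field.
by rewrite pnatr_eq0 -lt0n.
Qed.

Lemma jump_mean_le h f g : (forall o, f o <= g o) -> jump_mean h f <= jump_mean h g.
Proof.
move=> fg; apply: lerD.
  by apply: ler_sum => h' _; rewrite ler_wpM2l// divr_ge0.
by rewrite ler_wpM2l// subr_ge0.
Qed.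

Lemma jump_mean_shift h (u : R) (g : house V n -> R) :
  jump_mean h (fun o => u + (if o is Some h' then g h' else 0)) =
  u + \sum_h' P h.1 h'.1 / n%:R * g h'.
Proof.
rewrite /jump_mean addr0.
under eq_bigr do rewrite mulrDr.
rewrite big_split/= (sum_house_mean _ (fun=> u)) -big_distrl/=; ring.
Qed.

Lemma jump_mean_village h (u : R) (g : V -> R) :
  jump_mean h (fun o => u + (if o is Some h' then g h'.1 else 0)) =
  u + \sum_y P h.1 y * g y.
Proof. by rewrite (jump_mean_shift _ _ (fun h' => g h'.1)) sum_house_mean. Qed.

Lemma jump_mean_cst h (u : R) : jump_mean h (fun=> u) = u.
Proof.
by rewrite /jump_mean (sum_house_mean _ (fun=> u)) -big_distrl/=; ring.
Qed.

Lemma exit_rateE (z : state) :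
  exit_rate rate z = \sum_h act z h + \sum_h sleep_rate z h.
Proof.
have := sum_rate z (fun=> 1); rewrite /exit_rate.
under eq_bigr do rewrite mulr1.
move=> ->; congr (_ + _); apply: eq_bigr => h _; last by rewrite mulr1.
by rewrite jump_mean_cst mulr1.
Qed.

Lemma varw_rate_ge0 (z : state) e : 0 <= rate z e.
Proof.
case: e => [[h [h'|]]|h] /=; last by case: ifP.
  by rewrite mulr_ge0// divr_ge0.
by rewrite mulr_ge0// subr_ge0.
Qed.

Definition config_sum (f : house V n -> option nat -> R) (c : config V n) : R :=
  \sum_h f h (c h).

Lemma config_sum_update f (c : config V n) h o :
  config_sum f [ffun h' => if h' == h then o else c h'] =
  config_sum f c + (f h o - f h (c h)).
Proof.
rewrite /config_sum (bigD1 h)//= [X in _ = X + _](bigD1 h)//= ffunE eqxx.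
rewrite (eq_bigr (fun i => f i (c i))); first by ring.
by move=> i /negPf ih; rewrite ffunE ih.
Qed.

Lemma config_sum_depart f h (c : config V n) : config_sum f (depart h c) =
  config_sum f c + (f h (Some (active_at c h).-1) - f h (c h)).
Proof. exact: config_sum_update. Qed.

Lemma config_sum_arrive f h (c : config V n) : config_sum f (arrive h c) =
  config_sum f c + (f h (if c h is Some k then Some k.+1 else Some 2%N) - f h (c h)).
Proof. exact: config_sum_update. Qed.

Lemma config_sum_asleep f h (c : config V n) : config_sum f (fall_asleep h c) =
  config_sum f c + (f h None - f h (c h)).
Proof. exact: config_sum_update. Qed.

Definition particles (o : option nat) : R := if o is Some k then k%:R else 1.
Definition active (o : option nat) : R := if o is Some k then k%:R else 0.

(** * The Lyapunov function *)

Section Lyapunov.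
Variable w : V -> R.
Hypothesis w_ge0 : forall x, 0 <= w x.
Hypothesis Pw_le : forall x, \sum_y P x y * w y + 1 <= w x.

Definition lyapunov (z : state) : R :=
  config_sum (fun h o => 2 * w h.1 * particles o + active o) z.1.

Lemma lyapunov_ge0 z : 0 <= lyapunov z.
Proof.
apply: sumr_ge0 => h _; rewrite addr_ge0 ?mulr_ge0//; first by case: (z.1 h).
by case: (z.1 h) => /=.
Qed.

(** A jump from [h] to [h'] changes the function by at most [1 - 2 * w h.1 + 2 * w h'.1], the 1
    accounting for a woken sleeper; by the choice of [w] and the factor 2, its mean is at most -1. A
    fall asleep removes one active particle. *)
Lemma lyapunov_super (z : state) :
  \sum_e rate z e * (lyapunov (step z e) - lyapunov z) <= - exit_rate rate z.
Proof.
rewrite sum_rate exit_rateE opprD; apply: lerD; rewrite -[leRHS]sumrN.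
  apply: ler_sum => h _; rewrite -[leRHS]mulrN1.
  rewrite /active_at; case zh : (z.1 h) => [[|k]|]; rewrite ?mul0r//.
  rewrite ler_pM2l ?ltr0n//.
  apply: (@le_trans _ _ (jump_mean h (fun o => (1 - 2 * w h.1) +
     if o is Some h' then 2 * w h'.1 else 0))).
    apply: jump_mean_le => -[h'|] /=; rewrite /lyapunov /=.
      rewrite config_sum_arrive config_sum_depart /active_at zh /=.
      case: (depart h z.1 h') => [j|] /=; rewrite -?(natr1 k) -?(natr1 j); lra.
    rewrite config_sum_depart /active_at zh /=; rewrite -(natr1 k); lra.
  rewrite (jump_mean_village _ _ (fun y => 2 * w y)).
  under eq_bigr do rewrite mulrCA.
  by rewrite -big_distrr/=; have := Pw_le h.1; lra.
apply: ler_sum => h _; rewrite -[leRHS]mulrN1 /sleep_rate.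
case: eqP => [zh|_]; last by rewrite !mul0r.
by rewrite ler_wpM2l// /lyapunov /= config_sum_asleep zh /=; lra.
Qed.

End Lyapunov.

(** * Arrivals, flow balance and charge *)

Lemma count_jumpE x (M : {ffun V -> nat}) y : count_jump x M y = (M y + (y == x))%N.
Proof. by rewrite ffunE. Qed.

(* Up to the additive constant [- #|A_x|], the number of arrivals in village [x]. *)
Definition arrivals (x : V) (z : state) : R :=
  config_sum (fun h o => (h.1 == x)%:R * particles o) z.1 + (z.2 x)%:R.

(** A departure only moves a particle from the first term into the jump counter, so the landing
    alone is seen. *)
Lemma arrivals_jump x (z : state) h o k : z.1 h = Some k.+1 ->
  arrivals x (step z (inl (h, o))) =
  arrivals x z + (if o is Some h' then (h'.1 == x)%:R else 0).
Proof.
move=> zh; rewrite /arrivals; case: o => [h'|] /=.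
  rewrite config_sum_arrive config_sum_depart count_jumpE /active_at zh natrD /=.
  rewrite (eq_sym x); case: (depart h z.1 h') => [j|] /=.
    by rewrite -(natr1 k) -(natr1 j); ring.
  by rewrite -(natr1 k); ring.
by rewrite config_sum_depart count_jumpE /active_at zh natrD /= (eq_sym x) -(natr1 k); ring.
Qed.

Lemma arrivals_sleep x (z : state) h : z.1 h = Some 1%N ->
  arrivals x (step z (inr h)) = arrivals x z.
Proof. by move=> zh; rewrite /arrivals /= config_sum_asleep zh subrr addr0. Qed.

Lemma kernel_le1 x y : P x y <= 1.
Proof. by apply: le_trans (P_le1 x); rewrite (bigD1 y)//= lerDl sumr_ge0. Qed.

(* The increments of [flow_gap] under jumps are centred and bounded by 1. *)
Definition flow_gap (x : V) (j0 : R) (z : state) : R :=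
  arrivals x z - \sum_y (z.2 y)%:R * P y x - j0.

Lemma flow_gap_sqr_super x j0 (z : state) :
  \sum_e rate z e * (flow_gap x j0 (step z e) ^+ 2 - flow_gap x j0 z ^+ 2) <=
  \sum_h act z h.
Proof.
rewrite sum_rate -[leRHS]addr0; apply: lerD; last first.
  rewrite big1// => h _; rewrite /sleep_rate; case: eqP => [zh|]; rewrite ?mul0r//.
  by rewrite /flow_gap arrivals_sleep// subrr mulr0.
apply: ler_sum => h _; rewrite -[leRHS]mulr1 /active_at.
case zh : (z.1 h) => [[|k]|]; rewrite ?mul0r//.
rewrite ler_pM2l ?ltr0n//.
set J := flow_gap x j0 z; set p := P h.1 x.
have p0 : 0 <= p by exact: P_ge0.
have p1 : p <= 1 by exact: kernel_le1.
have JE o : flow_gap x j0 (step z (inl (h, o))) =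
    J + (if o is Some h' then (h'.1 == x)%:R else 0) - p.
  rewrite /flow_gap (arrivals_jump _ _ zh) /J /flow_gap.
  have -> : \sum_y ((step z (inl (h, o))).2 y)%:R * P y x =
            \sum_y (z.2 y)%:R * P y x + p.
    rewrite (_ : (step _ _).2 = count_jump h.1 z.2); last by case: (o).
    under eq_bigr do rewrite count_jumpE natrD mulrDl.
    rewrite big_split/=; congr (_ + _).
    rewrite (bigD1 h.1)//= eqxx mul1r big1 ?addr0// => y /negPf ->.
    by rewrite mul0r.
  ring.
(* An increment [xi] of [J] changes the square by [2 * J * xi + xi ^+ 2]; here [xi ^+ 2 <= 1], and
   the linear term has mean 0. *)
apply: (@le_trans _ _ (jump_mean h (fun o => (1 - 2 * J * p) +
    if o is Some h' then 2 * J * (h'.1 == x)%:R else 0))).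
  have pp : p ^+ 2 <= p by rewrite expr2 ler_piMl.
  apply: jump_mean_le => o; rewrite JE.
  by case: o => [h'|]; first case: (h'.1 == x) => /=; lra.
rewrite (jump_mean_village _ _ (fun y => 2 * J * (y == x)%:R)).
rewrite (bigD1 x)//= eqxx big1 => [|y /negPf ->]; last by rewrite !mulr0.
by rewrite -/p /=; lra.
Qed.

(* The weights are chosen so that an isolated particle, which falls asleep at rate
   [lambda] and jumps at rate 1, leaves the charge constant in mean, and so that
   any arrival in a house resets its charge to 0. *)
Definition house_charge (x : V) (h : house V n) (o : option nat) : R :=
  (h.1 == x)%:R *
  match o with None => 1 | Some 0%N => - lambda x | Some _.+1 => 0 end.

Definition charge (x : V) (z : state) : R := config_sum (house_charge x) z.1.

Lemma house_charge_sqr_le x h o : house_charge x h o ^+ 2 <= (1 + lambda x) ^+ 2.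
Proof.
have := lambda_ge0 x; rewrite /house_charge; case: (h.1 == x); case: o => [[|k]|] /=; nra.
Qed.

Lemma sum_village (x : V) (f : house V n -> R) :
  \sum_h (h.1 == x)%:R * f h = \sum_(i < n) f (x, i).
Proof.
rewrite (eq_bigr (fun h => (h.1 == x)%:R * f (h.1, h.2))); last by move=> [].
rewrite -(pair_bigA _ (fun y i => (y == x)%:R * f (y, i)))/=.
rewrite (bigD1 x)//= [X in _ + X]big1 ?addr0 => [|y /negPf yx].
  by apply: eq_bigr => i _; rewrite eqxx mul1r.
by rewrite big1// => i _; rewrite yx mul0r.
Qed.

(** The hypothesis on the sum says that [u - b i] has average [(1 - 1/n) * D]. Below, [D] is the gap
    after a departure and [u - b i] the gap after landing in house [i]: a uniform landing adds at
    most [K] to the mean square. *)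
Lemma mean_sqr_recentre (u D K : R) (b : 'I_n -> R) :
  (forall i, b i ^+ 2 <= K) ->
  \sum_i b i = n%:R * u - (n%:R - 1) * D ->
  \sum_i (u - b i) ^+ 2 <= n%:R * (D ^+ 2 + K).
Proof.
move=> bK bS; have n1 : 1 <= n%:R :> R by rewrite ler1n.
have -> : \sum_i (u - b i) ^+ 2 = n%:R * u ^+ 2 - 2 * u * \sum_i b i + \sum_i b i ^+ 2.
  rewrite mulr_natl -[in X in X - _](card_ord n) -sumr_const big_distrr/= -sumrB -big_split/=.
  by apply: eq_bigr => i _; ring.
have : \sum_i b i ^+ 2 <= n%:R * K.
  rewrite mulr_natl -[in leRHS](card_ord n) -sumr_const; exact: ler_sum.
set S2 := \sum_i b i ^+ 2; rewrite bS => h.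
set N := n%:R in n1 h *.
suff : N * u ^+ 2 - 2 * u * (N * u - (N - 1) * D) <= N * D ^+ 2 by nra.
rewrite -subr_ge0.
have -> : N * D ^+ 2 - (N * u ^+ 2 - 2 * u * (N * u - (N - 1) * D)) =
  (N - 1) * (u - D) ^+ 2 + u ^+ 2 + D ^+ 2 by ring.
by rewrite addr_ge0 ?sqr_ge0// addr_ge0 ?sqr_ge0// mulr_ge0 ?sqr_ge0 ?subr_ge0.
Qed.

(* A uniform arrival multiplies by [1 - 1 / n] both the mean charge and the
   exponential factor. *)
Definition charge_gap (x : V) (b : R) (z : state) : R :=
  charge x z - b * expR (arrivals x z * ln (1 - n%:R^-1)).

Lemma charge_gap_sqr_super x b (z : state) : (1 < n)%N ->
  \sum_e rate z e * (charge_gap x b (step z e) ^+ 2 - charge_gap x b z ^+ 2) <=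
  2 * (1 + lambda x) ^+ 2 * \sum_h act z h.
Proof.
move=> n1; rewrite sum_rate -big_split/= big_distrr/=; apply: ler_sum => h _.
have n0 : n%:R != 0 :> R by rewrite pnatr_eq0 -lt0n.
set D := charge_gap x b z; set K := (1 + lambda x) ^+ 2.
have lx := lambda_ge0 x.
have K1 : 1 <= K by rewrite /K; nra.
have KL : lambda x + lambda x ^+ 2 <= K by rewrite /K; nra.
(* Change of charge when a particle leaves [h]: [- lambda x] if it was alone there and [h] is in
   village [x], and 0 otherwise. *)
pose a k := house_charge x h (Some k) - house_charge x h (Some k.+1).
have jump k : z.1 h = Some k.+1 ->
    jump_mean h (fun o => charge_gap x b (step z (inl (h, o))) ^+ 2 - D ^+ 2) <=
    (D + a k) ^+ 2 + K - D ^+ 2.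
  move=> zh.
  pose c := depart h z.1.
  have cc : config_sum (house_charge x) c = charge x z + a k.
    by rewrite config_sum_depart /active_at zh.
  (* One arrival removes a fraction [1/n] of the exponential term, hence adds [be] to the gap. *)
  pose be := b * expR (arrivals x z * ln (1 - n%:R^-1)) / n%:R.
  have q0 : 0 < 1 - n%:R^-1 :> R by rewrite subr_gt0 invf_lt1 ?ltr1n ?ltr0n.
  have cgN : charge_gap x b (step z (inl (h, None))) = D + a k.
    by rewrite /D /charge_gap (arrivals_jump _ _ zh) addr0 {1}/charge /= cc; ring.
  have cgS h' : charge_gap x b (step z (inl (h, Some h'))) =
      D + a k + (h'.1 == x)%:R * (be - house_charge x h' (c h')).
    rewrite /D /charge_gap (arrivals_jump _ _ zh) {1}/charge /= config_sum_arrive.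
    rewrite cc mulrDl expRD /be /house_charge; case: eqP => _ /=; last first.
      by rewrite !mul0r expR0; ring.
    rewrite !mul1r lnK//; case: (depart _ _ _) => [[|j]|]; field; exact: n0.
  have P0 := P_ge0 h.1 x.
  pose s := \sum_(i < n) ((D + a k + be - house_charge x (x, i) (c (x, i))) ^+ 2
                          - (D + a k) ^+ 2).
  have -> : jump_mean h (fun o => charge_gap x b (step z (inl (h, o))) ^+ 2 - D ^+ 2) =
      (D + a k) ^+ 2 - D ^+ 2 + P h.1 x / n%:R * s.
    pose f h' := (D + a k + be - house_charge x h' (c h')) ^+ 2 - (D + a k) ^+ 2.
    transitivity (jump_mean h (fun o => (D + a k) ^+ 2 - D ^+ 2 +
        if o is Some h' then (h'.1 == x)%:R * f h' else 0)).
      rewrite /jump_mean; congr (_ + _ * _); last by rewrite cgN; ring.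
      apply: eq_bigr => h' _; rewrite cgS /f; case: (h'.1 == x) => /=; ring.
    rewrite jump_mean_shift; congr (_ + _); rewrite /s big_distrr/=.
    rewrite -(sum_village x (fun h' => P h.1 x / n%:R * f h')).
    apply: eq_bigr => h' _; case: eqP => [->|_]; first by rewrite !mul1r.
    by rewrite !mul0r mulr0.
  have sK : s <= n%:R * K.
    rewrite /s sumrB sumr_const card_ord -[X in _ - X]mulr_natl.
    rewrite lerBlDr.
    apply: (@le_trans _ _ (n%:R * ((D + a k) ^+ 2 + K))); last by rewrite mulrDr addrC.
    apply: mean_sqr_recentre; first by move=> i; exact: house_charge_sqr_le.
    rewrite -(sum_village x (fun h' => house_charge x h' (c h'))).
    rewrite (eq_bigr (fun h' => house_charge x h' (c h'))).
      rewrite -/(config_sum _ c) cc /be /D /charge_gap; field.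
      exact: n0.
    by move=> h' _; rewrite /house_charge mulrA; case: (h'.1 == x); rewrite ?mul1r ?mul0r.
  have := kernel_le1 h.1 x.
  have : P h.1 x / n%:R * s <= P h.1 x * K.
    rewrite -mulrA ler_wpM2l// mulrC ler_pdivrMr ?ltr0n// mulrC //.
  nra.
rewrite /sleep_rate /active_at; case zh : (z.1 h) => [[|k]|] /=;
  rewrite ?mul0r ?mulr0 ?addr0 //.
have {}jump := jump k zh.
case: k => [|k] in zh jump *; last first.
  rewrite /= mul0r addr0 mulrC ler_pM2r ?ltr0n//; apply: le_trans jump _.
  by rewrite /a /house_charge subrr addr0; lra.
rewrite eqxx mul1r mulr1.
have cgs : charge_gap x b (step z (inr h)) = D + (h.1 == x)%:R.
  rewrite /D /charge_gap arrivals_sleep// {1}/charge /= config_sum_asleep zh /=.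
  by rewrite /house_charge /charge; ring.
rewrite cgs; apply: le_trans (lerD jump (lexx _)) _.
(* In village [x] the terms [- 2 * lambda x * D] of the jump and [2 * lambda x * D] of the sleep
   cancel; what remains is [lambda x ^+ 2 + lambda x + K], at most [2 * K]. *)
rewrite /a /house_charge; case: eqP => [->|_] /=; last by rewrite !mul0r subrr !addr0; lra.
by rewrite !mul1r !subr0; lra.
Qed.

End Generator.

(** * Initial configuration *)

Lemma sum_bool_card (R : nzRingType) (T : finType) (b : pred T) :
  \sum_x (b x)%:R = #|b|%:R :> R.
Proof.
rewrite -sum1_card natr_sum [RHS]big_mkcond; apply: eq_bigr => x _.
by rewrite -topredE /=; case: (b x).
Qed.

Section UniformPlacement.
Variables (R : realType) (V : finType) (n : nat) (N : V -> nat).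
Hypothesis n_gt1 : (1 < n)%N.

Local Notation placement := {ffun added N -> 'I_n}.

Definition placement_mean (F : placement -> R) : R := (\sum_f F f) / #|{: placement}|%:R.

Let n0 : n%:R != 0 :> R.
Proof. by rewrite pnatr_eq0 -lt0n ltnW. Qed.

(** Independence of the added particles, obtained from distributivity. *)
Lemma placement_mean_prod (G : added N -> 'I_n -> R) :
  placement_mean (fun f => \prod_p G p (f p)) = \prod_p ((\sum_j G p j) / n%:R).
Proof.
rewrite /placement_mean -(bigA_distr_bigA G) big_split/=; congr (_ * _).
by rewrite card_ffun card_ord prodr_const natrX exprVn.
Qed.

Lemma prod_added (x : V) (r : R) :
  \prod_(p : added N) (if tag p == x then r else 1) = r ^+ N x.
Proof.
rewrite -(sig_big_dep (fun _ => true) (fun _ _ => true)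
            (fun y (_ : 'I_(N y)) => if y == x then r else 1))/=.
rewrite (bigD1 x)//= eqxx prodr_const card_ord big1 ?mulr1// => y /negPf ->.
by rewrite big1.
Qed.

(** Indicator that no added particle lands in the houses [B] of village [x], as a product so that
    its mean factorises. *)
Definition untouched (x : V) (B : {set 'I_n}) (f : placement) : R :=
  \prod_p (if (tag p == x) && (f p \in B) then 0 else 1).

Lemma placement_mean_untouched x B :
  placement_mean (untouched x B) = (1 - #|B|%:R / n%:R) ^+ N x.
Proof.
rewrite -prod_added
  (placement_mean_prod (fun p j => if (tag p == x) && (j \in B) then 0 else 1)).
apply: eq_bigr => p _; case: eqP => _ /=; last first.
  by rewrite sumr_const card_ord divff.
have -> : \sum_(j < n) (if j \in B then 0 else 1 : R) = n%:R - #|B|%:R.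
  rewrite -[in n%:R](card_ord n) -sum1_card natr_sum -sum1_card natr_sum.
  rewrite [X in _ = _ - X]big_mkcond/= -sumrB; apply: eq_bigr => j _.
  by case: (j \in B); ring.
by rewrite mulrBl divff.
Qed.

Lemma untouchedM x B C f : untouched x B f * untouched x C f = untouched x (B :|: C) f.
Proof.
rewrite -big_split/=; apply: eq_bigr => p _; rewrite finset.in_setU.
by case: (tag p == x); case: (f p \in B); case: (f p \in C);
  rewrite /= ?mul0r ?mulr0 ?mulr1.
Qed.

Lemma expr_sub_le (a b : R) k : 0 <= a -> a <= b -> b <= 1 ->
  0 <= b ^+ k - a ^+ k <= k%:R * (b - a).
Proof.
move=> a0 ab b1; elim: k => [|k /andP[IH1 IH2]]; first by rewrite subrr mul0r lexx.
have b0 := le_trans a0 ab.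
have ak0 : 0 <= a ^+ k by rewrite exprn_ge0.
have ak1 : a ^+ k <= 1 by rewrite exprn_ile1// (le_trans ab).
have -> : b ^+ k.+1 - a ^+ k.+1 = b * (b ^+ k - a ^+ k) + a ^+ k * (b - a).
  by rewrite !exprS; ring.
rewrite -natr1; apply/andP; split; nra.
Qed.

(** For [i != j] the covariance is a difference of [N x]-th powers of [1 - 2/n] and
    [(1 - 1/n) ^+ 2]; both bases lie in [0, 1] and differ by [1/n ^+ 2]. *)
Lemma placement_cov x (i j : 'I_n) :
  `|placement_mean (fun f => (untouched x [set i]%SET f - (1 - n%:R^-1) ^+ N x) *
                             (untouched x [set j]%SET f - (1 - n%:R^-1) ^+ N x))| <=
  (i == j)%:R + (N x)%:R / n%:R ^+ 2.
Proof.
set Q := (1 - n%:R^-1) ^+ N x.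
have mean1 k : placement_mean (untouched x [set k]%SET) = Q.
  by rewrite placement_mean_untouched cards1 div1r.
have c0 : #|{: placement}|%:R != 0 :> R.
  by rewrite pnatr_eq0 -lt0n card_ffun card_ord expn_gt0 (ltnW n_gt1).
have -> : placement_mean (fun f => (untouched x [set i]%SET f - Q) *
                             (untouched x [set j]%SET f - Q)) =
    placement_mean (untouched x ([set i] :|: [set j])%SET) - Q ^+ 2.
  transitivity (placement_mean (untouched x ([set i] :|: [set j])%SET) -
    Q * placement_mean (untouched x [set i]%SET) -
    Q * placement_mean (untouched x [set j]%SET) + Q ^+ 2).
    rewrite /placement_mean.
    set c := _%:R in c0 *.
    transitivity ((\sum_f untouched x ([set i] :|: [set j])%SET f -
      Q * \sum_f untouched x [set i]%SET f - Q * \sum_f untouched x [set j]%SET f +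
      Q ^+ 2 * c) / c); last by field.
    congr (_ / _).
    rewrite [Q ^+ 2 * _]mulr_natr -sumr_const !big_distrr/= -!sumrB -big_split/=.
    by apply: eq_bigr => f _; rewrite -untouchedM; ring.
  by rewrite !mean1; ring.
have n2 : 2 <= n%:R :> R by rewrite ler_nat.
have np : 0 < n%:R :> R by rewrite ltr0n ltnW.
have i0 : 0 < n%:R^-1 :> R by rewrite invr_gt0.
have i2 : n%:R^-1 <= 2^-1 :> R by rewrite lef_pV2 ?posrE.
have r0 : 0 <= (N x)%:R / n%:R ^+ 2 :> R by rewrite divr_ge0 ?exprn_ge0 ?ler0n.
have Q0 : 0 <= Q by apply: exprn_ge0; lra.
have Q1 : Q <= 1 by apply: exprn_ile1; lra.
rewrite placement_mean_untouched cards2; case: eqVneq => [_|_] /=.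
  rewrite div1r -/Q ger0_norm; last by nra.
  by rewrite mulr1n; nra.
rewrite add0r /Q -exprM mulnC exprM.
have := @expr_sub_le (1 - 2 / n%:R) ((1 - n%:R^-1) ^+ 2) (N x).
have -> : (1 - n%:R^-1) ^+ 2 - (1 - 2 / n%:R) = (n%:R ^+ 2)^-1 :> R by field.
have a0 : 0 <= 1 - 2 / n%:R :> R by lra.
have ab : 1 - 2 / n%:R <= (1 - n%:R^-1) ^+ 2 :> R by have := sqr_ge0 (n%:R^-1 : R); lra.
have b1 : (1 - n%:R^-1) ^+ 2 <= 1 :> R by apply: exprn_ile1; lra.
move=> /(_ a0 ab b1)/andP[h1 h2]; rewrite distrC.
by rewrite ger0_norm.
Qed.

Section InitialCharge.
Variables (lambda : V -> R) (A : {set house V n}).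
Hypothesis lambda_ge0 : forall x, 0 <= lambda x.

Local Notation start f := (init_config A f, [ffun=> 0%N] : {ffun V -> nat}).

Lemma particles_init (f : placement) h :
  particles R (init_config A f h) = (h \in A)%:R + \sum_p ((tag p, f p) == h)%:R.
Proof.
rewrite /init_config ffunE /= card_mkset (sum_bool_card R (fun p => _ == h)).
set k := #|_|.
by case: (h \in A); case: k => [|k] /=; rewrite ?add0r ?addr0// -[in LHS]natr1 addrC.
Qed.

(** Any added particle resets the charge of its house to 0, whether or not it finds a sleeper
    there. *)
Lemma house_charge_init (f : placement) x i :
  house_charge lambda x (x, i) (init_config A f (x, i)) =
  house_charge lambda x (x, i) (if (x, i) \in A then None else Some 0%N) *
  untouched x [set i]%SET f.
Proof.
rewrite /init_config ffunE /= card_mkset /house_charge eqxx !mul1r /untouched.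
case: (pickP (fun p : added N => (tag p, f p) == (x, i))) => [p pi|no].
  have /eqP[tx fi] := pi.
  rewrite [X in _ = _ * X](bigD1 p)//= tx fi inE !eqxx !mul0r mulr0.
  have : (0 < #|fun p0 : added N => (tag p0, f p0) == (x, i)|)%N by apply/card_gt0P; exists p.
  by case: #|_| => // k _; case: ((x, i) \in A).
rewrite big1 => [|p _].
  by rewrite (eq_card0 (A := fun p0 => _)) ?mulr1//; case: ((x, i) \in A).
by have := no p; rewrite xpair_eqE finset.in_set1 => ->.
Qed.

Lemma arrivals_init (f : placement) x :
  arrivals R x (start f) = #|[set i : 'I_n | (x, i) \in A]|%:R + (N x)%:R.
Proof.
rewrite /arrivals /= ffunE addr0 /config_sum.
rewrite (sum_village _ (fun h => particles R (init_config A f h))).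
under eq_bigr do rewrite particles_init.
rewrite big_split/= card_mkset (sum_bool_card R (fun i => (x, i) \in A)).
congr (_ + _); rewrite exchange_big/=.
transitivity (\sum_(p : added N) (if tag p == x then 1 else 0 : R)).
  apply: eq_bigr => p _; rewrite (bigD1 (f p))//= xpair_eqE eqxx andbT.
  rewrite big1 ?addr0 => [|i]; first by case: (tag p == x).
  by rewrite xpair_eqE eq_sym andbC => /negPf ->.
rewrite -(sig_big_dep (fun _ => true) (fun _ _ => true)
            (fun y (_ : 'I_(N y)) => if y == x then 1 else 0))/=.
rewrite (bigD1 x)//= eqxx sumr_const card_ord big1 ?addr0// => y /negPf ->.
by rewrite big1.
Qed.

Definition initial_charge (x : V) : R :=
  config_sum (house_charge lambda x) [ffun h => if h \in A then None else Some 0%N].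

(** [arrivals] starts at the number of sleepers plus [N x]; this factor cancels the sleepers, so
    that the exponential term starts at the mean charge after the placement. *)
Definition rescaled_charge (x : V) : R :=
  initial_charge x *
  expR (- (#|[set i : 'I_n | (x, i) \in A]|%:R * ln (1 - n%:R^-1))).

(** The initial gap is a combination of the centred indicators [untouched], with bounded
    coefficients: the diagonal covariances give the term [n], the others the term [N x]. *)
Lemma placement_mean_charge x :
  placement_mean (fun f => charge_gap lambda x (rescaled_charge x) (start f) ^+ 2) <=
  (1 + lambda x) ^+ 2 * (n%:R + (N x)%:R).
Proof.
pose c i : R := house_charge lambda x (x, i) (if (x, i) \in A then None else Some 0%N).
pose Q : R := (1 - n%:R^-1) ^+ N x.
have q0 : 0 < 1 - n%:R^-1 :> R by rewrite subr_gt0 invf_lt1 ?ltr1n ?ltr0n ?(ltnW n_gt1).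
have gapE f : charge_gap lambda x (rescaled_charge x) (start f) =
    \sum_i c i * (untouched x [set i]%SET f - Q).
  rewrite /charge_gap arrivals_init /rescaled_charge /initial_charge -mulrA -expRD.
  rewrite (_ : - _ + _ = (N x)%:R * ln (1 - n%:R^-1)); last by ring.
  rewrite expRM_natl lnK ?posrE// -/Q.
  have cs (c' : config V n) : config_sum (house_charge lambda x) c' =
      \sum_i house_charge lambda x (x, i) (c' (x, i)).
    rewrite -(sum_village x (fun h' => house_charge lambda x h' (c' h'))).
    apply: eq_bigr => h _.
    by rewrite /house_charge mulrA; case: (h.1 == x); rewrite ?mul1r ?mul0r.
  rewrite /charge !cs big_distrl/= -sumrB; apply: eq_bigr => i _.
  by rewrite house_charge_init ffunE -/(c i); ring.
have -> : placement_mean (fun f => charge_gap lambda x (rescaled_charge x) (start f) ^+ 2) =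
  \sum_i \sum_j c i * c j * placement_mean (fun f =>
    (untouched x [set i]%SET f - Q) * (untouched x [set j]%SET f - Q)).
  rewrite /placement_mean; under eq_bigr do rewrite gapE expr2 big_distrlr/=.
  rewrite exchange_big big_distrl/=; apply: eq_bigr => i _.
  rewrite exchange_big big_distrl/=; apply: eq_bigr => j _.
  rewrite mulrA big_distrr/=; congr (_ / _).
  by apply: eq_bigr => f _; ring.
pose K := (1 + lambda x) ^+ 2.
have cK i j : `|c i * c j| <= K.
  have h k : `|c k| <= 1 + lambda x.
    have l0 := lambda_ge0 x; rewrite /c /house_charge eqxx mul1r.
    by case: (_ \in A); rewrite ?normr1 ?normrN ?ger0_norm; lra.
  by rewrite normrM /K expr2 ler_pM.
apply: (@le_trans _ _ (\sum_(i < n) \sum_(j < n) K * ((i == j)%:R + (N x)%:R / n%:R ^+ 2))).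
  apply: ler_sum => i _; apply: ler_sum => j _.
  apply: le_trans (ler_norm _) _; rewrite normrM; apply: ler_pM => //.
  exact: placement_cov.
have row i : \sum_(j < n) K * ((i == j)%:R + (N x)%:R / n%:R ^+ 2) =
    K * (1 + n%:R * ((N x)%:R / n%:R ^+ 2)).
  rewrite -big_distrr big_split/= (bigD1 i)//= eqxx big1 => [|j]; last first.
    by rewrite eq_sym => /negPf ->.
  by rewrite addr0 sumr_const card_ord -[_ *+ n]mulr_natl.
under eq_bigr do rewrite row.
rewrite sumr_const card_ord -[_ *+ n]mulr_natl -/K le_eqVlt; apply/orP; left.
apply/eqP; field; exact: n0.
Qed.

End InitialCharge.
End UniformPlacement.

(** * Final configuration *)

Lemma expR_sub1_le (R : realType) (y : R) : `|y| <= 2^-1 -> `|expR y - 1| <= 2 * `|y|.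
Proof.
rewrite ler_norml => /andP[y1 y2].
have h1 := expR_ge1Dx y; have h2 := expR_ge1Dx (- y).
have h3 : expR y * expR (- y) = 1 by rewrite -expRD subrr expR0.
have h4 := expR_gt0 y.
have h5 : expR y * (1 - y) <= 1 by nra.
rewrite ler_norml; have [y0|/ltW y0] := leP 0 y.
  by rewrite (ger0_norm y0); apply/andP; split; nra.
by rewrite (ler0_norm y0); apply/andP; split; nra.
Qed.

(** The bound is uniform in [i]: the dilation by [a] costs at most [a - 1] because
    [i * expR (- i) <= 1], and the shift by [e] at most [4 * |e|]. *)
Lemma expR_perturb (R : realType) (a i e : R) : 1 <= a -> a <= 2 -> 0 <= i ->
  `|e| <= 4^-1 -> `|expR (- (a * (i + e))) - expR (- i)| <= a - 1 + 4 * `|e|.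
Proof.
move=> a1 a2 i0 e4; have e0 := normr_ge0 e.
have -> : - (a * (i + e)) = - (a * i) + - (a * e) by ring.
rewrite expRD.
have ai : i <= a * i by nra.
have ai0 : 0 <= a * i by nra.
have h1 : expR (- (a * i)) <= 1 by rewrite -expR0 ler_expR oppr_le0.
have h0 := expR_gt0 (- (a * i)).
have h2 : `|expR (- (a * e)) - 1| <= 4 * `|e|.
  apply: le_trans (expR_sub1_le _) _; rewrite normrN normrM (ger0_norm (_ : 0 <= a)); nra.
have h3 : expR (- i) - expR (- (a * i)) <= a - 1.
  have -> : - (a * i) = - i + - ((a - 1) * i) by ring.
  rewrite expRD.
  have l1 := expR_ge1Dx (- ((a - 1) * i)); have l2 := expR_ge1Dx i.
  have l3 : expR i * expR (- i) = 1 by rewrite -expRD subrr expR0.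
  have l4 := expR_gt0 (- i).
  have l5 : i * expR (- i) <= 1 by nra.
  have l6 : expR (- i) * (1 - (a - 1) * i) <= expR (- i) * expR (- ((a - 1) * i)).
    by rewrite ler_pM2l.
  have l7 : (a - 1) * (i * expR (- i)) <= a - 1 by rewrite ler_piMr// subr_ge0.
  nra.
have h4 : expR (- (a * i)) <= expR (- i) by rewrite ler_expR lerN2.
move: h2; set X := expR (- (a * e)); rewrite !ler_norml => /andP[x1 x2].
apply/andP; split; nra.
Qed.

(** With [t = 1/n <= 1/2], the number [- ln (1 - t)] lies between [t] and [t / (1 - t)], itself at
    most [t * (1 + 2 * t)]. *)
Lemma ln_one_sub_inv (R : realType) (n : nat) : (1 < n)%N ->
  1 <= - (n%:R * ln (1 - n%:R^-1 : R)) <= 1 + 2 / n%:R.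
Proof.
move=> n1; have n2 : 2 <= n%:R :> R by rewrite ler_nat.
have n0 : 0 < n%:R :> R by lra.
have i0 : 0 < n%:R^-1 :> R by rewrite invr_gt0.
have i2 : n%:R^-1 <= 2^-1 :> R by rewrite lef_pV2 ?posrE.
have q0 : 0 < 1 - n%:R^-1 :> R by lra.
set t := n%:R^-1 in i0 i2 q0 *; set l := ln _.
have el : expR l = 1 - t by rewrite lnK.
have nt : n%:R * t = 1 :> R by rewrite divff// gt_eqF.
have h1 := expR_ge1Dx l; rewrite el in h1.
have h2 := expR_ge1Dx (- l).
have h3 : expR l * expR (- l) = 1 by rewrite -expRD subrr expR0.
rewrite el in h3.
have h4 : (1 - t) * (1 - l) <= 1 by nra.
apply/andP; split; first by nra.
have h5 : - l * (1 - t) <= t by nra.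
have h6 : - l <= t * (1 + 2 * t) by nra.
have : n%:R * (- l) <= n%:R * (t * (1 + 2 * t)) by rewrite ler_pM2l.
by rewrite mulrA nt mul1r mulrN.
Qed.

Section FinalConfiguration.
Variables (R : realType) (V : finType) (P : V -> V -> R) (lambda sigma nu : V -> R).
Variables (n : nat) (A : {set house V n}).
Hypothesis P_ge0 : forall x y, 0 <= P x y.
Hypothesis P_le1 : forall x, \sum_y P x y <= 1.
Hypothesis lambda_ge0 : forall x, 0 <= lambda x.
Hypothesis sigma_01 : forall x, 0 <= sigma x <= 1.
Hypothesis nu_ge0 : forall x, 0 <= nu x.
Hypothesis n_gt1 : (1 < n)%N.
Hypothesis cardA : forall x, #|[set i : 'I_n | (x, i) \in A]| = Num.truncn (sigma x * n%:R).

Local Notation state := (varw_state V n).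
Local Notation sleepers z x := (#|[set i : 'I_n | z.1 (x, i) == None]|).
Local Notation nR := (n%:R : R).
Local Notation added_number x := (Num.truncn (nu x * nR)).

Let n_gt0 : (0 < n)%N. Proof. exact: ltnW. Qed.
Let nR_gt0 : 0 < nR. Proof. by rewrite ltr0n. Qed.

Lemma truncn_close (r : R) : 0 <= r ->
  `|(Num.truncn (r * nR))%:R / nR - r| <= nR^-1.
Proof.
move=> r0; have rn : 0 <= r * nR by rewrite mulr_ge0.
have /andP[h1 h2] := archimedean.Num.Theory.truncn_itv rn.
have e : (Num.truncn (r * nR))%:R / nR - r = ((Num.truncn (r * nR))%:R - r * nR) / nR.
  by field; rewrite gt_eqF.
have t0 : 0 <= nR^-1 by rewrite invr_ge0 ltW.
rewrite e normrM (ger0_norm t0) ler_piMl//.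
by rewrite ler_norml; move: h2; rewrite -natr1 => h2; apply/andP; split; lra.
Qed.

Lemma absorbing_active (z : state) h :
  exit_rate (@varw_rate R V P lambda n) z = 0 -> z.1 h = None \/ z.1 h = Some 0%N.
Proof.
rewrite exit_rateE// => e0.
have S0 : 0 <= \sum_h sleep_rate lambda z h.
  by apply: sumr_ge0 => h' _; rewrite /sleep_rate; case: ifP.
have : (active_at z.1 h)%:R <= 0 :> R.
  have : \sum_h (active_at z.1 h)%:R <= 0 :> R by lra.
  by apply: le_trans; rewrite [leRHS](bigD1 h)//= lerDl sumr_ge0.
by rewrite lern0 /active_at; case: (z.1 h) => [[|k]|] // _; [right|left].
Qed.

Lemma absorbed_arrivals (z : state) x :
  exit_rate (@varw_rate R V P lambda n) z = 0 ->
  arrivals R x z = (sleepers z x)%:R + (z.2 x)%:R.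
Proof.
move=> e0; rewrite /arrivals; congr (_ + _); rewrite /config_sum.
rewrite (sum_village _ (fun h => particles R (z.1 h))) card_mkset.
rewrite -(sum_bool_card R (fun i => z.1 (x, i) == None)).
by apply: eq_bigr => i _; have [->|->] := absorbing_active (x, i) e0.
Qed.

Lemma absorbed_charge (z : state) x :
  exit_rate (@varw_rate R V P lambda n) z = 0 ->
  charge lambda x z = (1 + lambda x) * (sleepers z x)%:R - lambda x * nR.
Proof.
move=> e0; rewrite /charge /config_sum /house_charge.
rewrite (sum_village _ (fun h => match z.1 h with
  None => 1 | Some 0%N => - lambda x | Some _.+1 => 0 end)) card_mkset.
rewrite -(sum_bool_card R (fun i => z.1 (x, i) == None)) big_distrr/=.
rewrite -[in X in _ = _ - X](card_ord n) mulr_natr -sumr_const -sumrB.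
by apply: eq_bigr => i _; have [->|->] := absorbing_active (x, i) e0; rewrite /=; ring.
Qed.

Lemma initial_chargeE x :
  initial_charge lambda A x = (1 + lambda x) * (Num.truncn (sigma x * nR))%:R - lambda x * nR.
Proof.
rewrite /initial_charge /config_sum /house_charge.
under eq_bigr do rewrite ffunE.
rewrite (sum_village _ (fun h => match (if h \in A then None else Some 0%N) with
  None => 1 | Some 0%N => - lambda x | Some _.+1 => 0 end)) -cardA card_mkset.
rewrite -(sum_bool_card R (fun i => (x, i) \in A)) big_distrr/=.
rewrite -[in X in _ = _ - X](card_ord n) mulr_natr -sumr_const -sumrB.
by apply: eq_bigr => i _; case: ((x, i) \in A); rewrite /=; ring.
Qed.

(** At absorption only sleepers remain. The flow gap then reads as the first fluid equation, and the
    charge gap divided by [(1 + lambda x) * n] as the second. *)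
Lemma absorbed_almost_solution (z : state) (delta : R) x :
  exit_rate (@varw_rate R V P lambda n) z = 0 -> 0 <= delta ->
  delta + nR^-1 <= 4^-1 ->
  `|charge_gap lambda x (rescaled_charge lambda A x) z| <= delta * nR ->
  `|flow_gap P x ((Num.truncn (sigma x * nR))%:R + (added_number x)%:R) z| <= delta * nR ->
  let s' := fun y => (sleepers z y)%:R / nR in
  let m' := fun y => (z.2 y)%:R / nR in
  `|s' x - (- m' x + sigma x + inflow P nu m' x)| <= 5 * delta + 7 / nR /\
  `|s' x - stable_density lambda sigma x (inflow P nu m' x)| <= 5 * delta + 7 / nR.
Proof.
move=> e0 d0 dn hc hf s' m'.
have /andP[s0 s1] := sigma_01 x; have l0 := lambda_ge0 x.
have tA := truncn_close s0; have tN := truncn_close (nu_ge0 x).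
set a := _ / nR in tA; set b := _ / nR in tN.
have t0 : 0 < nR^-1 by rewrite invr_gt0.
have m'0 y : 0 <= m' y by rewrite divr_ge0.
have i0 : 0 <= inflow P nu m' x.
  by rewrite addr_ge0// sumr_ge0// => y _; rewrite mulr_ge0.
(* Arrivals per house that actually took place, minus the fluid inflow. *)
pose e := s' x + m' x - a - inflow P nu m' x.
have gapf : `|e - (b - nu x)| <= delta.
  rewrite -(ler_pM2r nR_gt0) -[X in _ * X](ger0_norm (ltW nR_gt0)) -normrM.
  move: hf; rewrite /flow_gap absorbed_arrivals//; congr (`|_| <= _).
  rewrite /e /s' /m' /a /b /inflow.
  have -> : \sum_y (z.2 y)%:R / nR * P y x = (\sum_y (z.2 y)%:R * P y x) / nR.
    by rewrite big_distrl/=; apply: eq_bigr => y _; ring.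
  by field; rewrite gt_eqF.
have ebound : `|e| <= delta + nR^-1.
  by move: gapf tN; rewrite !ler_norml => /andP[? ?] /andP[? ?]; apply/andP; split; lra.
split.
  move: ebound tA; rewrite /e !ler_norml => /andP[? ?] /andP[? ?]; apply/andP; split; lra.
set i := inflow P nu m' x in i0 e ebound gapf *.
(* The power of [1 - 1/n] with exponent [n * u] is [expR (- (th * u))], and [th] is close to 1. *)
pose th := - (nR * ln (1 - nR^-1)).
have /andP[th1 th2] := ln_one_sub_inv R n_gt1.
rewrite -/th in th1 th2.
have th3 : th <= 2 by lra.
have hX := expR_perturb th1 th3 i0 (le_trans ebound dn).
set X := expR _ in hX; set Z := expR (- i) in hX.
have Z0 : 0 <= Z by exact: expR_ge0.
have Z1 : Z <= 1 by rewrite -expR0 ler_expR oppr_le0.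
pose rho := lambda x / (1 + lambda x).
have rho0 : 0 <= rho by apply: asleep_prob_ge0.
have rho1 : rho < 1 by exact: asleep_prob_lt1.
have a0 : 0 <= a by rewrite divr_ge0 ?ler0n.
have a1 : a <= 1.
  rewrite ler_pdivrMr// mul1r; apply: le_trans (_ : sigma x * nR <= _).
    by have /andP[] := archimedean.Num.Theory.truncn_itv (mulr_ge0 s0 (ltW nR_gt0)).
  by rewrite ler_piMl// ltW.
have hs : `|s' x - rho - (a - rho) * X| <= delta.
  have L0 : 0 < (1 + lambda x) * nR by rewrite mulr_gt0//; lra.
  rewrite -(ler_pM2r L0) -[X in _ * X <= _](ger0_norm (ltW L0)) -normrM.
  apply: (@le_trans _ _ (delta * nR)); last first.
    by rewrite ler_wpM2l// ler_peMl ?(ltW nR_gt0)// lerDl.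
  move: hc; rewrite /charge_gap absorbed_arrivals// absorbed_charge//.
  rewrite /rescaled_charge initial_chargeE cardA -mulrA -expRD.
  have -> : - ((Num.truncn (sigma x * nR))%:R * ln (1 - nR^-1)) +
    ((sleepers z x)%:R + (z.2 x)%:R) * ln (1 - nR^-1) = - (th * (i + e)).
    by rewrite /e /s' /m' /a /th; field; rewrite gt_eqF.
  rewrite -/X; congr (`|_| <= _); rewrite /s' /rho /a; field.
  by rewrite !gt_eqF//; lra.
(* Three errors: the charge gap gives [delta], the exponential [2/n + 4 * (delta + 1/n)], the
   rounding of [sigma x * n] gives [1/n]; in total [5 * delta + 7/n]. *)
have -> : s' x - stable_density lambda sigma x i =
   (s' x - rho - (a - rho) * X) + (a - rho) * (X - Z) + (a - sigma x) * Z.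
  by rewrite /stable_density -/rho -/Z; ring.
apply: le_trans (ler_normD _ _) _.
have n1 : `|(a - sigma x) * Z| <= nR^-1.
  by rewrite normrM (ger0_norm Z0); apply: le_trans tA; rewrite ler_piMr.
have n2 : `|(a - rho) * (X - Z)| <= `|X - Z|.
  by rewrite normrM ler_piMl// ler_norml; apply/andP; split; lra.
have n3 := ler_normD (s' x - rho - (a - rho) * X) ((a - rho) * (X - Z)).
have e' := normr_ge0 e.
lra.
Qed.

End FinalConfiguration.

(** * Concentration *)

Section Concentration.
Variables (R : realType) (V : finType) (P : V -> V -> R) (lambda sigma nu : V -> R).
Hypothesis P_irr : substochastic_irreducible P.
Hypothesis lambda_ge0 : forall x, 0 <= lambda x.
Hypothesis sigma_01 : forall x, 0 <= sigma x <= 1.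
Hypothesis nu_ge0 : forall x, 0 <= nu x.

Let P_ge0 x y : 0 <= P x y. Proof. by case: P_irr. Qed.
Let P_le1 x : \sum_y P x y <= 1. Proof. by case: P_irr. Qed.

Section Size.
Variables (n : nat) (A : {set house V n}) (w : V -> R).
Hypothesis w_ge0 : forall x, 0 <= w x.
Hypothesis Pw_le : forall x, \sum_y P x y * w y + 1 <= w x.
Hypothesis n_gt1 : (1 < n)%N.
Hypothesis cardA : forall x, #|[set i : 'I_n | (x, i) \in A]| = Num.truncn (sigma x * n%:R).

Local Notation state := (varw_state V n).
Local Notation nR := (n%:R : R).
Local Notation N := (fun x => Num.truncn (nu x * nR)).
Local Notation rate := (@varw_rate R V P lambda n).
Local Notation step := (@varw_step V n).

Let n_gt0 : (0 < n)%N. Proof. exact: ltnW. Qed.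

(** Sum over the villages of the drift coefficients of the two squared gaps. *)
Definition total_weight : R := \sum_x (2 * (1 + lambda x) ^+ 2 + 1).

Definition discrepancy (z : state) : R :=
  \sum_x (charge_gap lambda x (rescaled_charge lambda A x) z ^+ 2 +
          flow_gap P x ((Num.truncn (sigma x * nR))%:R + (N x)%:R) z ^+ 2) +
  total_weight * lyapunov w z.

Lemma total_weight_ge0 : 0 <= total_weight.
Proof. by apply: sumr_ge0 => x _; rewrite addr_ge0// mulr_ge0// sqr_ge0. Qed.

Lemma discrepancy_ge_sqr x (z : state) :
  charge_gap lambda x (rescaled_charge lambda A x) z ^+ 2 <= discrepancy z /\
  flow_gap P x ((Num.truncn (sigma x * nR))%:R + (N x)%:R) z ^+ 2 <= discrepancy z.
Proof.
have L0 := mulr_ge0 total_weight_ge0 (lyapunov_ge0 w_ge0 z).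
rewrite /discrepancy (bigD1 x)//=.
set S := \sum_(_ | _) _.
have S0 : 0 <= S by apply: sumr_ge0 => y _; rewrite addr_ge0 ?sqr_ge0.
set a := charge_gap _ _ _ _; set b := flow_gap _ _ _ _.
have := sqr_ge0 a; have := sqr_ge0 b; lra.
Qed.

Lemma discrepancy_ge0 (z : state) : 0 <= discrepancy z.
Proof.
rewrite addr_ge0 ?mulr_ge0 ?total_weight_ge0 ?lyapunov_ge0//.
by apply: sumr_ge0 => y _; rewrite addr_ge0 ?sqr_ge0.
Qed.

(** The squares drift upwards by at most [total_weight] times the jump rate, and the Lyapunov term,
    with that same weight, drifts downwards by at least as much. *)
Lemma discrepancy_super (z : state) :
  \sum_e rate z e * (discrepancy (step z e) - discrepancy z) <= 0.
Proof.
pose a := \sum_h (active_at z.1 h)%:R : R.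
pose c x (z' : state) := charge_gap lambda x (rescaled_charge lambda A x) z' ^+ 2.
pose f x (z' : state) := flow_gap P x ((Num.truncn (sigma x * nR))%:R + (N x)%:R) z' ^+ 2.
have -> : \sum_e rate z e * (discrepancy (step z e) - discrepancy z) =
  \sum_x (\sum_e rate z e * (c x (step z e) - c x z) +
          \sum_e rate z e * (f x (step z e) - f x z)) +
  total_weight * \sum_e rate z e * (lyapunov w (step z e) - lyapunov w z).
  under [in RHS]eq_bigr do rewrite -big_split/=.
  rewrite exchange_big/= big_distrr/= -big_split/=; apply: eq_bigr => e _.
  under eq_bigr do rewrite -mulrDr.
  rewrite -big_distrr/= mulrCA -mulrDr; congr (_ * _).
  rewrite /discrepancy opprD addrACA -mulrBr; congr (_ + _).
  by rewrite -sumrB; apply: eq_bigr => x _; rewrite /c /f; ring.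
have h1 : \sum_x (\sum_e rate z e * (c x (step z e) - c x z) +
          \sum_e rate z e * (f x (step z e) - f x z)) <= total_weight * a.
  rewrite big_distrl/=; apply: ler_sum => x _; rewrite mulrDl mul1r; apply: lerD.
    exact: charge_gap_sqr_super.
  exact: flow_gap_sqr_super.
have h2 := lyapunov_super P_ge0 P_le1 lambda_ge0 n_gt0 Pw_le z.
have h3 : a <= exit_rate rate z.
  rewrite exit_rateE// lerDl sumr_ge0// => h _; rewrite /sleep_rate.
  by case: ifP.
have t0 := total_weight_ge0.
have h4 : total_weight * \sum_e rate z e * (lyapunov w (step z e) - lyapunov w z) <=
    total_weight * - exit_rate rate z by rewrite ler_wpM2l.
have h5 : total_weight * a <= total_weight * exit_rate rate z by rewrite ler_wpM2l.
lra.
Qed.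

Lemma lyapunov_le_arrivals (z : state) : lyapunov w z <= \sum_x (2 * w x + 1) * arrivals R x z.
Proof.
apply: (@le_trans _ _ (\sum_x (2 * w x + 1) * \sum_h (h.1 == x)%:R * particles R (z.1 h))).
  under eq_bigr do rewrite big_distrr/=.
  rewrite exchange_big/=; apply: ler_sum => h _.
  rewrite (bigD1 h.1)//= eqxx mul1r big1 ?addr0 => [|x /negPf].
    by rewrite [leRHS]mulrDl lerD2l mul1r; case: (z.1 h) => //=.
  by rewrite eq_sym => ->; rewrite mul0r mulr0.
apply: ler_sum => x _; rewrite ler_wpM2l ?addr_ge0 ?mulr_ge0//.
by rewrite /arrivals lerDl.
Qed.

Definition discrepancy_const : R :=
  \sum_x (1 + lambda x) ^+ 2 * (1 + nu x) +
  total_weight * \sum_x (2 * w x + 1) * (1 + nu x).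

Lemma truncn_le (r : R) : 0 <= r -> (Num.truncn (r * nR))%:R <= r * nR.
Proof.
move=> r0; have rn : 0 <= r * nR by rewrite mulr_ge0.
by have /andP[] := archimedean.Num.Theory.truncn_itv rn.
Qed.

(** The flow gaps vanish initially, the charge gaps have variance of order [n], and the Lyapunov
    function is bounded by the number of particles up to a constant. *)
Lemma discrepancy_init :
  placement_mean (fun f : {ffun added N -> 'I_n} =>
    discrepancy (init_config A f, [ffun=> 0%N])) <= discrepancy_const * nR.
Proof.
set st := fun f : {ffun added N -> 'I_n} => (init_config A f, [ffun=> 0%N] : {ffun V -> nat}).
have c0 : #|{: {ffun added N -> 'I_n}}|%:R != 0 :> R.
  by rewrite pnatr_eq0 -lt0n card_ffun card_ord expn_gt0 n_gt0.
pose L := total_weight * \sum_x (2 * w x + 1) * (1 + nu x) * nR.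
apply: (@le_trans _ _ (placement_mean (fun f =>
   \sum_x charge_gap lambda x (rescaled_charge lambda A x) (st f) ^+ 2 + L))).
  rewrite /placement_mean ler_wpM2r ?invr_ge0//; apply: ler_sum => f _.
  apply: lerD.
    apply: ler_sum => x _; rewrite /flow_gap arrivals_init// cardA big1 => [|y _].
      by rewrite subr0 subrr expr0n/= addr0.
    by rewrite /= ffunE mul0r.
  rewrite ler_wpM2l ?total_weight_ge0//.
  apply: le_trans (lyapunov_le_arrivals _) _; apply: ler_sum => x _.
  rewrite -mulrA ler_wpM2l ?addr_ge0 ?mulr_ge0// arrivals_init// cardA mulrDl mul1r.
  have /andP[s0 s1] := sigma_01 x.
  apply: lerD; last exact: truncn_le.
  by apply: le_trans (truncn_le s0) _; rewrite ler_piMl.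
have -> : placement_mean (fun f =>
   \sum_x charge_gap lambda x (rescaled_charge lambda A x) (st f) ^+ 2 + L) =
  \sum_x placement_mean (fun f =>
     charge_gap lambda x (rescaled_charge lambda A x) (st f) ^+ 2) + L.
  rewrite /placement_mean big_split/= mulrDl sumr_const -[L *+ _]mulr_natr mulfK//.
  by rewrite exchange_big/= big_distrl.
rewrite /discrepancy_const mulrDl; apply: lerD.
  rewrite big_distrl/=; apply: ler_sum => x _.
  apply: le_trans (placement_mean_charge _ n_gt1 _ lambda_ge0 x) _.
  rewrite -mulrA ler_wpM2l ?sqr_ge0// mulrDl mul1r lerD2l; exact: truncn_le.
by rewrite /L -mulrA ler_wpM2l ?total_weight_ge0// big_distrl.
Qed.

Section Process.
Variables (d : measure_display) (Omega : measurableType d) (Pr : probability Omega R).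
Variables (Y : nat -> Omega -> state) (T : nat -> Omega -> \bar R).
Hypothesis varw : is_varw P lambda sigma nu A Pr Y T.

(** A maximal inequality for [discrepancy]: its initial mean is of order [n], whereas failure
    requires order [n ^+ 2]. *)
Lemma probability_varw_final (Q : pred state) (delta : R) : 0 < delta ->
  (forall z, exit_rate rate z = 0 -> Q z -> (delta * nR) ^+ 2 <= discrepancy z) ->
  (Pr [set w0 | Q (varw_final Y T w0)] <= (discrepancy_const / delta ^+ 2 / nR)%:E)%E.
Proof.
move=> d0 Qd; have [_ mjp] := varw.
have nR0 : 0 < nR by rewrite ltr0n.
have dn0 : 0 < (delta * nR) ^+ 2 by rewrite exprn_gt0// mulr_gt0.
(* The states form a countable set, as the results on jump processes require. *)
pose S : countType := ({ffun house V n -> option nat} * {ffun V -> nat})%type.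
have c0 : (0 < #|{: {ffun added N -> 'I_n}}|)%N.
  by rewrite card_ffun card_ord expn_gt0 n_gt0.
have := @probability_final_state_le R d Omega Pr S _ {ffun added N -> 'I_n}
  _ rate step (fun f => (init_config A f, [ffun=> 0%N])) Y T
  ([ffun=> Some 0%N], [ffun=> 0%N]) (varw_rate_ge0 P_ge0 P_le1 lambda_ge0 (n := n))
  c0 (fun z => erefl) mjp (fun z => discrepancy z / (delta * nR) ^+ 2) (lyapunov w) Q.
move=> h; apply: le_trans (h _ _ _ _ _) _.
- by move=> z; rewrite divr_ge0 ?discrepancy_ge0// ltW.
- by move=> z; exact: lyapunov_ge0.
- move=> z; have -> : \sum_e rate z e *
     (discrepancy (step z e) / (delta * nR) ^+ 2 - discrepancy z / (delta * nR) ^+ 2) =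
     (\sum_e rate z e * (discrepancy (step z e) - discrepancy z)) / (delta * nR) ^+ 2.
    by rewrite big_distrl/=; apply: eq_bigr => e _; ring.
  by rewrite ler_pdivrMr// mul0r discrepancy_super.
- by move=> z; exact: lyapunov_super.
- by move=> z e0 Qz; rewrite ler_pdivlMr// mul1r; exact: Qd.
rewrite lee_fin -big_distrl/= mulrAC ler_pdivrMr//.
apply: le_trans discrepancy_init _.
rewrite le_eqVlt; apply/orP; left; apply/eqP; field.
by rewrite !gt_eqF.
Qed.

End Process.
End Size.

Hypothesis sigma_le : forall x, sigma x <= lambda x / (1 + lambda x).

Lemma varw_concentration (s m : {ffun V -> R}) (eps : R) :
  fluid_solution P lambda sigma nu s m -> 0 < eps ->
  exists (B : R) (n0 : nat), forall (n : nat) (A : {set house V n})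
    (d : measure_display) (Omega : measurableType d) (Pr : probability Omega R)
    (Y : nat -> Omega -> varw_state V n) (T : nat -> Omega -> \bar R),
  (n0 <= n)%N -> is_varw P lambda sigma nu A Pr Y T ->
  (Pr [set w | exists x, (eps < `|(sleepy_count Y T w x)%:R / n%:R - s x|)%R]
     <= (B / n%:R)%:E)%E /\
  (Pr [set w | exists x, (eps < `|(jump_count Y T w x)%:R / n%:R - m x|)%R]
     <= (B / n%:R)%:E)%E.
Proof.
move=> sol eps0; have [w [w0 wP]] := exit_time_supersolution P_irr.
have [C [C0 CP]] := fluid_stability P_irr lambda_ge0 sigma_01 nu_ge0 sigma_le.
(* The first bound gives [delta + 1/n <= 1/4] once [n >= 8], the second
   [C * (5 * delta) <= eps / 2]; [n0] below takes care of [C * (7/n)]. *)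
pose delta := Num.min (8^-1) (eps / (10 * (C + 1))).
have d0 : 0 < delta.
  by rewrite lt_min invr_gt0 ltr0n/= divr_gt0// mulr_gt0//; lra.
have d1 : delta <= 8^-1 by rewrite ge_min lexx.
have d2 : C * (5 * delta) <= eps / 2.
  have : delta <= eps / (10 * (C + 1)) by rewrite ge_min lexx orbT.
  by rewrite ler_pdivlMr; nra.
exists (discrepancy_const w / delta ^+ 2).
pose n0 := (Num.truncn (8 + 14 * C / eps)).+1.
exists n0 => n A d Omega Pr Y T nn varw.
have nbig : 8 + 14 * C / eps <= n%:R.
  apply: le_trans (ltW (archimedean.Num.Theory.truncnS_gt _)) _.
  by rewrite ler_nat.
have r0 : 0 <= 14 * C / eps by rewrite divr_ge0 ?mulr_ge0// ltW.
have n8 : 8 <= n%:R :> R by lra.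
have n1 : (1 < n)%N by rewrite -(ltr_nat R); lra.
have nR0 : 0 < n%:R :> R by lra.
have i8 : n%:R^-1 <= 8^-1 :> R by rewrite lef_pV2 ?posrE.
have d3 : C * (7 / n%:R) <= eps / 2.
  have h : 14 * C <= n%:R * eps by rewrite -ler_pdivrMr//; lra.
  by rewrite mulrA ler_pdivrMr//; lra.
have [cardA _] := varw.
have close z x : exit_rate (@varw_rate R V P lambda n) z = 0 ->
    discrepancy A w z < (delta * n%:R) ^+ 2 ->
    `|(#|[set i : 'I_n | z.1 (x, i) == None]|)%:R / n%:R - s x| <= eps /\
    `|(z.2 x)%:R / n%:R - m x| <= eps.
  move=> e0 dz.
  have dn0 : 0 <= delta * n%:R by rewrite mulr_ge0// ltW.
  have gap y := discrepancy_ge_sqr A w0 y z.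
  have sq (a : R) : a ^+ 2 <= discrepancy A w z -> `|a| <= delta * n%:R.
    move=> ha; rewrite -(ler_pXn2r (n := 2))// ?nnegrE//.
    by rewrite real_normK ?num_real// (le_trans ha)// ltW.
  have d8 : delta + n%:R^-1 <= 4^-1 by lra.
  have sol' y := absorbed_almost_solution P_ge0 lambda_ge0 sigma_01 nu_ge0
    n1 cardA e0 (ltW d0) d8 (sq _ (gap y).1) (sq _ (gap y).2).
  have e1 : 0 <= 5 * delta + 7 / n%:R by rewrite addr_ge0 ?divr_ge0// mulr_ge0// ltW.
  have := CP s m _ _ _ sol e1 _ (fun y => (sol' y).1) (fun y => (sol' y).2) x.
  case=> [y|h1 h2]; first by rewrite divr_ge0.
  have h3 : C * (5 * delta + 7 / n%:R) <= eps by rewrite mulrDr; lra.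
  by split; [apply: le_trans h1 _ | apply: le_trans h2 _].
pose Qs (z : varw_state V n) := [exists x, eps <
  `|(#|[set i : 'I_n | z.1 (x, i) == None]|)%:R / n%:R - s x|].
pose Qm (z : varw_state V n) := [exists x, eps < `|(z.2 x)%:R / n%:R - m x|].
have bound := @probability_varw_final n A w w0 wP n1 cardA d Omega Pr Y T varw.
split.
  rewrite (_ : [set _ | _] = [set w' | Qs (varw_final Y T w')]).
    apply: (bound Qs delta d0) => z e0 /existsP[x lt]; rewrite leNgt.
    by apply/negP => /(close z x e0)[h _]; rewrite ltNge h in lt.
  by apply/seteqP; split=> w' /=; [move=> [x h]; apply/existsP; exists x
                                  |move=> /existsP[x h]; exists x].
rewrite (_ : [set _ | _] = [set w' | Qm (varw_final Y T w')]).
  apply: (bound Qm delta d0) => z e0 /existsP[x lt]; rewrite leNgt.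
  by apply/negP => /(close z x e0)[_ h]; rewrite ltNge h in lt.
by apply/seteqP; split=> w' /=; [move=> [x h]; apply/existsP; exists x
                                |move=> /existsP[x h]; exists x].
Qed.

End Concentration.

Lemma cvg_probability_le (R : realType) (p : nat -> \bar R) (B : R) (n0 : nat) :
  (forall n, 0 <= p n)%E -> (forall n, (n0 <= n)%N -> (p n <= (B / n%:R)%:E)%E) ->
  p @ \oo --> 0%E.
Proof.
move=> p0 pB.
(* [harmonic n] is [1/(n+1)], which is at least half of [1/n] for [n >= 1]; hence the factor 2. *)
apply: (@squeeze_cvge _ _ _ _ (cst 0%E) p (fun n => (2 * `|B| * harmonic n)%:E)).
- exists n0.+1 => //= n nn; rewrite p0/=.
  have n1 : 1 <= n%:R :> R by rewrite ler1n (leq_ltn_trans _ nn).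
  apply: le_trans (pB n (ltnW nn)) _; rewrite lee_fin.
  rewrite ler_pdivrMr; last by lra.
  rewrite /harmonic mulrAC ler_pdivlMr ?ltr0n// -natr1.
  have := ler_norm B; have := normr_ge0 B; nra.
- exact: cvg_cst.
- apply/cvg_EFin; first by near=> n.
  rewrite -(mulr0 (2 * `|B|)); apply: cvgM; first exact: cvg_cst.
  exact: cvg_harmonic.
Unshelve. all: by end_near.
Qed.

Theorem theorem3p1 (R : realType) (V : finType) (P : V -> V -> R)
    (lambda sigma nu : V -> R)
    (V_nonempty : (0 < #|V|)%N)
    (P_irr : substochastic_irreducible P)
    (lambda_ge0 : forall x, 0 <= lambda x)
    (sigma_01 : forall x, 0 <= sigma x <= 1)
    (nu_ge0 : forall x, 0 <= nu x)
    (sigma_le : forall x, sigma x <= lambda x / (1 + lambda x)) :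
  (exists! sm : {ffun V -> R} * {ffun V -> R},
     fluid_solution P lambda sigma nu sm.1 sm.2) /\
  forall s m : {ffun V -> R}, fluid_solution P lambda sigma nu s m ->
  forall (d : nat -> measure_display)
    (Omega : forall n, measurableType (d n))
    (Pr : forall n, probability (Omega n) R)
    (A : forall n, {set house V n})
    (Y : forall n, nat -> Omega n -> varw_state V n)
    (T : forall n, nat -> Omega n -> \bar R),
  (forall n, (0 < n)%N -> is_varw P lambda sigma nu (A n) (Pr n) (Y n) (T n)) ->
  cvg_in_probability Pr
    (fun n w x => (sleepy_count (Y n) (T n) w x)%:R / n%:R) s /\
  cvg_in_probability Pr
    (fun n w x => (jump_count (Y n) (T n) w x)%:R / n%:R) m.
Proof.
split; first exact: fluid_solution_exists_unique.
move=> s m sol d Omega Pr A Y T varw.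
have concentration :=
  varw_concentration P_irr lambda_ge0 sigma_01 nu_ge0 sigma_le sol.
split=> eps eps0; have [B [n0 bound]] := concentration eps eps0;
  (* The processes are village models only for [n > 0], hence the maximum with 1. *)
  apply: (@cvg_probability_le R _ B (maxn n0 1)) => n; try exact: measure_ge0;
  rewrite geq_max => /andP[n0n n_gt0].
- by have [] := bound n (A n) _ _ (Pr n) (Y n) (T n) n0n (varw n n_gt0).
- by have [] := bound n (A n) _ _ (Pr n) (Y n) (T n) n0n (varw n n_gt0).
Qed.
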